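(* Let $V$ be a vector space over a field $\mathbb{F}$ with a linearly ordered basis $\mathbb{B}$, let $p\in\mathbb{F}$ be nonzero, and assume $[n]_p\neq0$ for all $n\ge1$ (so that all $p$-divided powers are defined). The action of the braiding $\hat\tau$ of $\Lambda_p(V)$ is of the form $$\hat\tau f_{E,F}=\sum_{k=0}^{\min(|E|,|F|)}\gamma_k\,L^{\langle|F|-k\rangle_p}R^{\langle|E|-k\rangle_p}f_{E,F}$$ for all finite subsets $E,F\subseteq\mathbb{B}$. Equivalently, for all $m,n\ge0$, $$\hat\tau(\pi_m\otimes\pi_n)=\sum_{k=0}^{\min(m,n)}\gamma_k\,(\nabla\otimes\mathrm{id})(\mathrm{id}\otimes\Delta_{n-k)})(\mathrm{id}\otimes\nabla)(\Delta_{(m-k}\otimes\mathrm{id})(\pi_m\otimes\pi_n).$$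
   Context: Braided Hopf algebra $\Lambda_p(V)$: let $\tau$ on $V\otimes V$ be given by $\tau(a\otimes a)=-a\otimes a$; $\tau(a\otimes b)=-(1-p)a\otimes b-b\otimes a$ if $a>b$; $\tau(a\otimes b)=-p\,b\otimes a$ if $a<b$ ($a,b\in\mathbb{B}$). As an algebra $\Lambda_p(V)$ is the exterior algebra $\bigwedge V$, with product $\nabla$ and unit $1$. Its braiding $\hat\tau$ is the unique linear map on $\Lambda_p(V)^{\otimes2}$ with $\hat\tau|_{V\otimes V}=\tau$, $\hat\tau(1\otimes x)=x\otimes1$, $\hat\tau(x\otimes1)=1\otimes x$, $\hat\tau(\nabla\otimes\nabla)=(\nabla\otimes\nabla)(\mathrm{id}\otimes\hat\tau\otimes\mathrm{id})(\hat\tau\otimes\hat\tau)(\mathrm{id}\otimes\hat\tau\otimes\mathrm{id})$. Its coproduct $\Delta$ is the unique linear map with $\Delta1=1\otimes1$, $\Delta v=v\otimes1+1\otimes v$ ($v\in V$), $\Delta\nabla=(\nabla\otimes\nabla)(\mathrm{id}\otimes\hat\tau\otimes\mathrm{id})(\Delta\otimes\Delta)$. Notation: for a finite $E=\{e_1<\dots<e_n\}\subseteq\mathbb{B}$, $f_E=e_1\cdots e_n$ ($f_\emptyset=1$); these form a basis of $\Lambda_p(V)$; $f_{E,F}=f_E\otimes f_F$. $\pi_k$ is the projection of $\Lambda_p(V)$ onto its degree $k$ part. $\Delta_{k)}=(\pi_k\otimes\mathrm{id})\Delta$, $\Delta_{(k}=(\mathrm{id}\otimes\pi_k)\Delta$.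 $L=(\nabla\otimes\mathrm{id})(\mathrm{id}\otimes\Delta_{1)})$ and $R=(\mathrm{id}\otimes\nabla)(\Delta_{(1}\otimes\mathrm{id})$ are endomorphisms of $\Lambda_p(V)^{\otimes2}$. $\gamma_k=(-1)^kp^{k(k-1)/2}$; $[n]_p=\sum_{i=0}^{n-1}p^i$; $[n]_p^!=\prod_{i=1}^n[i]_p$; $x^{\langle n\rangle_p}=x^n/[n]_p^!$. *)

(* Defs.v *)
From HB Require Import structures.
From mathcomp Require Import all_boot all_order all_algebra.
From mathcomp Require Import finmap.
From mathcomp.multinomials Require Import monalg.
Set Implicit Arguments.
Unset Strict Implicit.
Unset Printing Implicit Defensive.

Import Order.TTheory GRing.Theory.

Local Open Scope fset_scope.
Local Open Scope ring_scope.

Reserved Notation "x \ot y" (at level 40, left associativity).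
Reserved Notation "f \otm g" (at level 40, left associativity).

(* A vector space with basis I is modelled by the free module {malg F[I]}:
   finitely supported functions I -> F, the basis vector i being << i >>. *)

Section Free.
Variable F : fieldType.

Definition lext (I : choiceType) (W : lmodType F) (h : I -> W)
  (x : {malg F[I]}) : W := \sum_(i <- msupp x) x@_i *: h i.

Lemma lextEw (I : choiceType) (W : lmodType F) (h : I -> W)
  (x : {malg F[I]}) (D : {fset I}) :
  msupp x `<=` D -> lext h x = \sum_(i <- D) x@_i *: h i.
Proof.
move=> sD; rewrite /lext (big_fset_incl _ sD) // => i _ /mcoeff_outdom ->.
by rewrite scale0r.
Qed.

Lemma lext_is_linear (I : choiceType) (W : lmodType F) (h : I -> W) :
  linear (lext h).
Proof.
move=> a x y; pose D := msupp x `|` msupp y `|` msupp (a *: x + y).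
rewrite !(@lextEw _ _ h _ D) ?fsubsetUr //; last 2 first.
- by rewrite /D -fsetUA fsetUCA fsubsetUl.
- by rewrite /D -fsetUA fsubsetUl.
rewrite scaler_sumr -big_split; apply: eq_bigr => i _ /=.
by rewrite mcoeffD mcoeffZ scalerDl scalerA.
Qed.

HB.instance Definition _ (I : choiceType) (W : lmodType F) (h : I -> W) :=
  GRing.isLinear.Build F {malg F[I]} W _ (lext h) (lext_is_linear h).

Lemma lextU (I : choiceType) (W : lmodType F) (h : I -> W) i :
  lext h << i >> = h i.
Proof.
rewrite (@lextEw _ _ _ _ [fset i]) ?msuppU_le // big_seq_fset1.
by rewrite mcoeffUU scale1r.
Qed.

Lemma malg_expand (I : choiceType) (x : {malg F[I]}) :
  x = \sum_(i <- msupp x) x@_i *: (<< i >> : {malg F[I]}).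
Proof.
rewrite {1}[x]monalgE; apply: eq_bigr => i _.
by apply/malgP => k; rewrite mcoeffZ !mcoeffU mulr_natr.
Qed.

Lemma malg_linear_ext (I : choiceType) (W : lmodType F)
  (f g : {linear {malg F[I]} -> W}) :
  (forall i, f << i >> = g << i >>) -> f =1 g.
Proof.
move=> fg x; rewrite (malg_expand x) !linear_sum; apply: eq_bigr => i _ /=.
by rewrite !linearZ fg.
Qed.

End Free.

(* The tensor product of the spaces with bases I and J is the space with basis
   I * J; see tensor_univ. *)
Definition tensor (F : fieldType) (I J : choiceType)
  (x : {malg F[I]}) (y : {malg F[J]}) : {malg F[(I * J)%type]} :=
  lext (fun i => lext (fun j => << (i, j) >> : {malg F[(I * J)%type]}) y) x.

Notation "x \ot y" := (tensor x y) : ring_scope.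

(* For linear f and g, the map x (x) y |-> f x (x) g y; see tensm_tensor. *)
Definition tensm (F : fieldType) (I J I' J' : choiceType)
  (f : {malg F[I]} -> {malg F[I']}) (g : {malg F[J]} -> {malg F[J']}) :
  {malg F[(I * J)%type]} -> {malg F[(I' * J')%type]} :=
  lext (fun k => f << k.1 >> \ot g << k.2 >>).

Notation "f \otm g" := (tensm f g) : function_scope.

HB.instance Definition _ (F : fieldType) (I J I' J' : choiceType)
  (f : {malg F[I]} -> {malg F[I']}) (g : {malg F[J]} -> {malg F[J']}) :=
  GRing.Linear.on (tensm f g).

Section Tensor.
Variable F : fieldType.

Definition assocr (I J K : choiceType) :
  {malg F[((I * J) * K)%type]} -> {malg F[(I * (J * K))%type]} :=
  lext (fun k => << (k.1.1, (k.1.2, k.2)) >>).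
HB.instance Definition _ I J K := GRing.Linear.on (@assocr I J K).

Definition assocl (I J K : choiceType) :
  {malg F[(I * (J * K))%type]} -> {malg F[((I * J) * K)%type]} :=
  lext (fun k => << ((k.1, k.2.1), k.2.2) >>).
HB.instance Definition _ I J K := GRing.Linear.on (@assocl I J K).

(* id (x) f (x) id on a fourfold tensor power bracketed as (2)(2). *)
Definition mid (I : choiceType)
  (f : {malg F[(I * I)%type]} -> {malg F[(I * I)%type]}) :
  {malg F[((I * I) * (I * I))%type]} -> {malg F[((I * I) * (I * I))%type]} :=
  @assocl _ _ _ \o (id \otm (@assocr _ _ _ \o (f \otm id) \o @assocl _ _ _))
    \o @assocr _ _ _.
HB.instance Definition _ I f := GRing.Linear.on (@mid I f).

Variables I J : choiceType.

Lemma tensorDZl (y : {malg F[J]}) : linear (fun x : {malg F[I]} => x \ot y).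
Proof. by move=> a x x'; rewrite /tensor linearP. Qed.

Lemma tensorDZr (x : {malg F[I]}) : linear (fun y : {malg F[J]} => x \ot y).
Proof.
move=> a y y'; rewrite /tensor /lext scaler_sumr -big_split.
apply: eq_bigr => i _ /=; rewrite -/(lext _ _) linearP scalerDr !scalerA.
by rewrite mulrC.
Qed.

Lemma tensorU i j : (<< i >> : {malg F[I]}) \ot (<< j >> : {malg F[J]}) =
  << (i, j) >>.
Proof. by rewrite /tensor !lextU. Qed.

(* Universal property of the tensor product. *)
Lemma tensor_univ (W : lmodType F) (b : {malg F[I]} -> {malg F[J]} -> W) :
  (forall y, linear (b^~ y)) -> (forall x, linear (b x)) ->
  exists2 f : {linear {malg F[(I * J)%type]} -> W},
    forall x y, f (x \ot y) = b x y &
    forall g : {linear {malg F[(I * J)%type]} -> W},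
      (forall x y, g (x \ot y) = b x y) -> g =1 f.
Proof.
move=> bl br; pose f : {linear _ -> W} :=
  lext (fun k : I * J => b << k.1 >> << k.2 >>).
have fP x y : f (x \ot y) = b x y.
  pose bL y := HB.pack_for {linear {malg F[I]} -> W} (b^~ y)
    (GRing.isLinear.Build F _ _ _ (b^~ y) (bl y)).
  pose bR x := HB.pack_for {linear {malg F[J]} -> W} (b x)
    (GRing.isLinear.Build F _ _ _ (b x) (br x)).
  pose tL y := HB.pack_for {linear {malg F[I]} -> {malg F[(I * J)%type]}}
    (fun x : {malg F[I]} => x \ot y)
    (GRing.isLinear.Build F _ _ _ (fun x : {malg F[I]} => x \ot y)
       (tensorDZl y)).
  pose tR x := HB.pack_for {linear {malg F[J]} -> {malg F[(I * J)%type]}}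
    (fun y : {malg F[J]} => x \ot y)
    (GRing.isLinear.Build F _ _ _ (fun y : {malg F[J]} => x \ot y)
       (tensorDZr x)).
  apply: (malg_linear_ext (f := f \o tL y) (g := bL y)) => i.
  apply: (malg_linear_ext (f := f \o tR << i >>) (g := bR << i >>)) => j /=.
  by rewrite tensorU /f /= lextU.
exists f => // g gP; apply: malg_linear_ext => -[i j].
by rewrite -tensorU gP fP.
Qed.

Lemma tensm_tensor (I' J' : choiceType)
  (f : {linear {malg F[I]} -> {malg F[I']}})
  (g : {linear {malg F[J]} -> {malg F[J']}}) x y :
  (f \otm g) (x \ot y) = f x \ot g y.
Proof.
have bl y' : linear (fun x => f x \ot g y').
  by move=> a u v; rewrite linearP {1}/tensor linearP.
have br x' : linear (fun y => f x' \ot g y).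
  move=> a u v; rewrite linearP /tensor /lext scaler_sumr -big_split.
  apply: eq_bigr => i _ /=; rewrite -/(lext _ _) linearP scalerDr !scalerA.
  by rewrite mulrC.
have [h hP hU] := tensor_univ bl br.
rewrite -hP; apply: malg_linear_ext => -[i j].
by rewrite /= -[in RHS]tensorU hP; exact: lextU.
Qed.

End Tensor.

Arguments assocr {F I J K}.
Arguments assocl {F I J K}.

(* The exterior algebra of the space V = {malg F[B]}: basis f_E = << E >>
   indexed by the finite subsets E of B, and f_E f_G = 0 if E and G meet,
   f_E f_G = (-1)^{#{(x, y) in E * G | y < x}} f_{E u G} otherwise.
   See ext_univ for its universal property. *)
Definition extalg (F : fieldType) (d : Order.disp_t) (B : orderType d) :=
  {malg F[{fset B}]}.

Section Exterior.
Variables (F : fieldType) (d : Order.disp_t) (B : orderType d).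
Implicit Types E G H : {fset B}.
Local Notation La := (extalg F B).
Local Notation V := {malg F[B]}.

HB.instance Definition _ := GRing.Lmodule.on La.

Definition inversions E G : nat :=
  (\sum_(x <- E) \sum_(y <- G) (y < x)%O)%N.

Definition extmulb E G : La :=
  if [disjoint E & G]%fset then (-1) ^+ inversions E G *: << E `|` G >> else 0.

Definition extmul (x y : La) : La :=
  lext (fun E => lext (fun G => extmulb E G) y) x.

Let extmulDZl y : linear (extmul^~ y).
Proof. by move=> a x x'; rewrite /extmul linearP. Qed.

Let extmulDZr x : linear (extmul x).
Proof.
move=> a y y'; rewrite /extmul /lext scaler_sumr -big_split.
apply: eq_bigr => i _ /=; rewrite -/(lext _ _) linearP scalerDr !scalerA.
by rewrite mulrC.
Qed.

Let mL y := HB.pack_for {linear La -> La} (extmul^~ y)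
  (GRing.isLinear.Build F _ _ _ (extmul^~ y) (extmulDZl y)).
Let mR x := HB.pack_for {linear La -> La} (extmul x)
  (GRing.isLinear.Build F _ _ _ (extmul x) (extmulDZr x)).

Let mulx0 x : extmul x 0 = 0. Proof. exact: (linear0 (mR x)). Qed.
Let mul0x y : extmul 0 y = 0. Proof. exact: (linear0 (mL y)). Qed.
Let mulxZ a x y : extmul x (a *: y) = a *: extmul x y.
Proof. exact: (linearZ_LR (mR x)). Qed.
Let mulZx a x y : extmul (a *: x) y = a *: extmul x y.
Proof. exact: (linearZ_LR (mL y)). Qed.

Let extmulU E G : extmul << E >> << G >> = extmulb E G.
Proof. by rewrite /extmul !lextU. Qed.

Let big_fsetU E G (f : B -> nat) : [disjoint E & G]%fset ->
  (\sum_(x <- E `|` G) f x = \sum_(x <- E) f x + \sum_(x <- G) f x)%N.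
Proof.
move=> dEG; rewrite -big_cat /=; apply: perm_big; apply: uniq_perm.
- exact: fset_uniq.
- rewrite cat_uniq !fset_uniq andbT /=; apply/hasPn => x xG.
  by apply: contraTN xG => xE; apply: (fdisjointP dEG).
- by move=> x; rewrite mem_cat in_fsetU.
Qed.

Let invU E G H : [disjoint G & H]%fset ->
  inversions E (G `|` H) = (inversions E G + inversions E H)%N.
Proof.
move=> dGH; rewrite /inversions -big_split; apply: eq_bigr => x _ /=.
by rewrite big_fsetU.
Qed.

Let invUl E G H : [disjoint E & G]%fset ->
  inversions (E `|` G) H = (inversions E H + inversions G H)%N.
Proof. by move=> dEG; rewrite /inversions big_fsetU. Qed.

Let extmulA : associative extmul.
Proof.
move=> x y z.
apply: (malg_linear_ext (f := mL (extmul y z)) (g := mL z \o mL y)) => E /=.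
apply: (malg_linear_ext (f := mR << E >> \o mL z)
  (g := mL z \o mR << E >>)) => G /=.
apply: (malg_linear_ext (f := mR << E >> \o mR << G >>)
  (g := mR (extmul << E >> << G >>))) => H /=.
rewrite !extmulU /extmulb.
have [dGH|nGH] := boolP [disjoint G & H]%fset; last first.
  rewrite mulx0; case: ifP => _; last by rewrite mul0x.
  rewrite mulZx extmulU /extmulb fdisjointUX (negPf nGH) andbF.
  by rewrite scaler0.
rewrite mulxZ extmulU /extmulb fdisjointXU.
have [dEG|nEG] := boolP [disjoint E & G]%fset; last first.
  by rewrite mul0x scaler0.
rewrite mulZx extmulU /extmulb fdisjointUX dGH andbT /=.
have [dEH|nEH] := boolP [disjoint E & H]%fset; last first.
  by rewrite scaler0 scaler0.
rewrite scalerA scalerA fsetUA -exprD -exprD (invU _ dGH) (invUl _ dEG).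
by rewrite [X in _ ^+ X]addnC -addnA.
Qed.

Let ext1 : La := << fset0 >>.

Let ext1l : left_id ext1 extmul.
Proof.
move=> x; apply: (malg_linear_ext (f := mR ext1) (g := idfun)) => E /=.
rewrite extmulU /extmulb fdisjoint0X fset0U /inversions big_seq_fset0.
by rewrite scale1r.
Qed.

Let ext1r : right_id ext1 extmul.
Proof.
move=> x; apply: (malg_linear_ext (f := mL ext1) (g := idfun)) => E /=.
rewrite extmulU /extmulb fdisjointX0 fsetU0 /inversions big1.
  by rewrite scale1r.
by move=> y _; rewrite big_seq_fset0.
Qed.

Let ext1_neq0 : ext1 != 0.
Proof. by rewrite monalgU_eq0 oner_neq0. Qed.

Let extmulDl : left_distributive extmul +%R.
Proof. by move=> x y z; rewrite /extmul linearD. Qed.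

Let extmulDr : right_distributive extmul +%R.
Proof. by move=> x y z; exact: (linearD (mR x)). Qed.

HB.instance Definition _ := GRing.Zmodule_isNzRing.Build La extmulA ext1l ext1r
  extmulDl extmulDr ext1_neq0.

Let extmulZl a (x y : La) : a *: (x * y) = (a *: x) * y.
Proof. exact: esym (mulZx a x y). Qed.

Let extmulZr a (x y : La) : a *: (x * y) = x * (a *: y).
Proof. exact: esym (mulxZ a x y). Qed.

HB.instance Definition _ := GRing.Lmodule_isLalgebra.Build F La extmulZl.
HB.instance Definition _ := GRing.Lalgebra_isAlgebra.Build F La extmulZr.

(* The inclusion of V. *)
Definition iota1 : V -> La := lext (fun b => << [fset b] >>).
HB.instance Definition _ := GRing.Linear.on iota1.

(* f_E = e_1 ... e_n for E = {e_1 < ... < e_n}. *)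
Definition extb E : La := \prod_(e <- sort <=%O (enum_fset E)) iota1 << e >>.

Let mulU E G : (<< E >> : La) * (<< G >> : La) = extmulb E G.
Proof. exact: extmulU. Qed.

Let prod_sorted (s : seq B) : sorted <%O s ->
  \prod_(e <- s) iota1 << e >> = << [fset x in s] >> :> La.
Proof.
elim: s => [|e s IHs] /= ss.
  by rewrite big_nil; congr (<< _ >>); apply/fsetP => x; rewrite !inE.
rewrite big_cons IHs; last exact: path_sorted ss.
move: ss; rewrite lt_path_sortedE => /andP[/allP es _].
rewrite /iota1 lextU mulU /extmulb fdisjoint1X !inE.
case: ifPn => [_|/negPn /es]; last by rewrite ltxx.
rewrite /inversions big_seq_fset1 big_seq big1 ?scale1r => [|x]; last first.
  by rewrite !inE => /es /lt_gtF ->.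
by congr (<< _ >>); apply/fsetP => x; rewrite !inE.
Qed.

Lemma extbE E : extb E = << E >>.
Proof.
rewrite /extb prod_sorted; last first.
  by rewrite sort_lt_sorted fset_uniq.
by congr (<< _ >>); apply/fsetP => x; rewrite !inE mem_sort.
Qed.

Let sum_sq (A : algType F) (s : seq B) (c : B -> F) (a : B -> A) :
  (forall x, a x * a x = 0) -> (forall x y, a x * a y = - (a y * a x)) ->
  (\sum_(x <- s) c x *: a x) * (\sum_(x <- s) c x *: a x) = 0.
Proof.
move=> sq0 anti; elim: s => [|x s IHs]; first by rewrite big_nil mul0r.
rewrite big_cons mulrDl !mulrDr -scalerAl -scalerAr sq0 !scaler0 add0r IHs.
rewrite addr0 mulr_sumr mulr_suml -big_split big1 // => y _ /=.
by rewrite -!scalerAl -!scalerAr anti !scalerN !scalerA mulrC addNr.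
Qed.

Let gen x : La := << [fset x] >>.

Let genU x E : gen x * (<< E >> : La) =
  if x \in E then 0 else (-1) ^+ inversions [fset x] E *: << x |` E >>.
Proof. by rewrite mulU /extmulb fdisjoint1X; case: (x \in E). Qed.

Let gen_sq x : gen x * gen x = 0.
Proof. by rewrite genU !inE eqxx. Qed.

Let gen_anti x y : gen x * gen y = - (gen y * gen x).
Proof.
have [->|xy] := eqVneq x y; first by rewrite gen_sq oppr0.
rewrite !genU !inE [y == x]eq_sym (negPf xy) /inversions !big_seq_fset1.
rewrite -scaleNr (fsetUC [fset x]).
case: (ltgtP x y) xy => [_|_|_] xy; [| |by case/negP: xy].
  by rewrite expr0 expr1 opprK.
by rewrite expr0 expr1.
Qed.

Lemma iota1_sq v : iota1 v * iota1 v = 0.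
Proof. exact: (sum_sq _ _ gen_sq gen_anti). Qed.

Let genlt x E : (forall y, y \in E -> (x < y)%O) ->
  gen x * (<< E >> : La) = << x |` E >>.
Proof.
move=> xE; rewrite genU ifN; last by apply/negP => /xE; rewrite ltxx.
rewrite /inversions big_seq_fset1 big_seq big1 ?scale1r // => y /xE.
by move/lt_gtF->.
Qed.

Let fset_seq_cons x (s : seq B) :
  [fset y in x :: s] = x |` [fset y in s] :> {fset B}.
Proof. by apply/fsetP => y; rewrite !inE. Qed.

(* Stated over abstract algebras: with concrete elements of La in their place,
   failing unifications unfold {malg F[_]} and are very slow. *)
Section Abstract.
Variables (C A : algType F) (phi : {linear C -> A}).

Fact ext_spanl (g : C) (a : A) (I : Type) (s : seq I)
  (c : I -> F) (w : I -> C) :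
  (forall i, phi (g * w i) = a * phi (w i)) ->
  phi (g * \sum_(i <- s) c i *: w i) = a * phi (\sum_(i <- s) c i *: w i).
Proof.
move=> h; rewrite mulr_sumr !linear_sum mulr_sumr; apply: eq_bigr => i _ /=.
by rewrite -scalerAr !linearZ /= h scalerAr.
Qed.

Fact ext_spanr (y : C) (I : Type) (s : seq I) (c : I -> F) (w : I -> C) :
  (forall i, phi (w i * y) = phi (w i) * phi y) ->
  phi ((\sum_(i <- s) c i *: w i) * y) =
  phi (\sum_(i <- s) c i *: w i) * phi y.
Proof.
move=> h; rewrite mulr_suml !linear_sum mulr_suml; apply: eq_bigr => i _ /=.
by rewrite -scalerAl !linearZ /= h scalerAl.
Qed.

Fact ext_mulZ (g w : C) (a : A) (c : F) :
  phi (g * w) = a * phi w -> phi (g * (c *: w)) = a * phi (c *: w).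
Proof. by move=> h; rewrite -scalerAr !linearZ /= h scalerAr. Qed.

Fact ext_swap (gx gy z : C) (ax ay : A) :
  gx * gy = - (gy * gx) -> ax * ay = - (ay * ax) ->
  phi (gx * z) = ax * phi z -> phi (gy * (gx * z)) = ay * phi (gx * z) ->
  phi (gx * (gy * z)) = ax * (ay * phi z).
Proof.
move=> gC aC h h'; rewrite mulrA gC mulNr linearN -mulrA h' h.
by rewrite !mulrA aC mulNr.
Qed.

Fact ext_nil2 (g z : C) (a : A) :
  g * g = 0 -> a * a = 0 -> phi (g * (g * z)) = a * (a * phi z).
Proof. by move=> g0 a0; rewrite !mulrA g0 a0 !mul0r linear0. Qed.

Fact ext_mul_step (g y z : C) (a : A) :
  (forall w, phi (g * w) = a * phi w) -> phi (z * y) = phi z * phi y ->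
  phi (g * z * y) = phi (g * z) * phi y.
Proof. by move=> h h'; rewrite -mulrA !h h' mulrA. Qed.

End Abstract.

(* Universal property of the exterior algebra. *)
Lemma ext_univ (A : algType F) (j : {linear V -> A}) :
  (forall v, j v * j v = 0) ->
  exists2 phi : {lrmorphism La -> A},
    phi \o iota1 =1 j &
    forall psi : {lrmorphism La -> A}, psi \o iota1 =1 j -> psi =1 phi.
Proof.
move=> sq0; pose a x := j << x >>.
have asq x : a x * a x = 0 by exact: sq0.
have anti x y : a x * a y = - (a y * a x).
  apply/eqP; rewrite -subr_eq0 opprK; apply/eqP.
  have := sq0 (<< x >> + << y >>).
  by rewrite linearD mulrDl !mulrDr -!/(a _) !asq add0r addr0.
pose phi : {linear La -> A} :=
  lext (fun E => \prod_(e <- sort <=%O (enum_fset E)) a e).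
have phiS s : sorted <%O s -> phi << [fset x in s] >> = \prod_(x <- s) a x.
  move=> ss; rewrite /phi /= lextU; congr (\big[_/_]_(_ <- _) _).
  apply: (irr_sorted_eq lt_trans ltxx) => //.
    by rewrite sort_lt_sorted fset_uniq.
  by move=> x; rewrite mem_sort !inE.
have seqE E : exists2 s, sorted <%O s & E = [fset x in s].
  exists (sort <=%O (enum_fset E)); first by rewrite sort_lt_sorted fset_uniq.
  by apply/fsetP => x; rewrite !inE mem_sort.
have phi_lt x E : (forall y, y \in E -> (x < y)%O) ->
    phi (gen x * << E >>) = a x * phi << E >>.
  have [s ss ->] := seqE E => xs; rewrite genlt // phiS // -fset_seq_cons.
  rewrite phiS ?big_cons //= lt_path_sortedE ss andbT.
  by apply/allP => y ys; apply: xs; rewrite !inE.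
have phi_gen x E : phi (gen x * << E >>) = a x * phi << E >>.
  have [s + ->] := seqE E; elim: s => [|y s IHs] /= ys.
    by apply: phi_lt => z; rewrite !inE.
  have ss := path_sorted ys.
  move: (ys); rewrite lt_path_sortedE => /andP[/allP ylt _].
  have yE : << [fset z in y :: s] >> = gen y * << [fset z in s] >>.
    by rewrite fset_seq_cons genlt // => z; rewrite !inE => /ylt.
  have phiyE : phi (gen y * << [fset z in s] >>) =
      a y * phi << [fset z in s] >>.
    by apply: phi_lt => z; rewrite !inE => /ylt.
  case: (ltgtP x y) => [xy|yx|xy].
  - apply: phi_lt => z; rewrite !inE => /orP[/eqP-> //|/ylt].
    exact: lt_trans.
  - rewrite yE [X in _ = _ * X]phiyE.
    apply: (ext_swap (gen_anti x y) (anti x y) (IHs ss)).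
    rewrite genU; case: ifP => _; first by rewrite mulr0 linear0 mulr0.
    apply: ext_mulZ; apply: phi_lt => z; rewrite !inE => /orP[/eqP-> //|].
    exact: ylt.
  - by rewrite yE [X in _ = _ * X]phiyE xy; exact: ext_nil2 (gen_sq y) (asq y).
have phi1 : phi 1 = 1.
  have <- : << [fset x in [::] : seq B] >> = 1 :> La.
    by congr (<< _ >>); apply/fsetP => x; rewrite !inE.
  by rewrite phiS // big_nil.
have phiUM E (y : La) : phi ((<< E >> : La) * y) = phi << E >> * phi y.
  have [s + ->] := seqE E; elim: s y => [|x s IHs] y /= ss.
    rewrite phiS // big_nil mul1r; congr (phi _); rewrite -[RHS]mul1r.
    by congr (_ * _); congr (<< _ >>); apply/fsetP => z; rewrite !inE.
  move: (ss); rewrite lt_path_sortedE => /andP[/allP xlt _].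
  rewrite fset_seq_cons -genlt => [|z]; last by rewrite !inE => /xlt.
  have phixM z : phi (gen x * z) = a x * phi z.
    by rewrite (malg_expand z); apply: ext_spanl => E'; exact: phi_gen.
  apply: (ext_mul_step phixM); apply: IHs; exact: path_sorted ss.
have phiM (x y : La) : phi (x * y) = phi x * phi y.
  by rewrite (malg_expand x); apply: ext_spanr => E; exact: phiUM.
pose phiR := HB.pack_for {lrmorphism La -> A} (phi : La -> A)
  (GRing.Linear.class phi)
  (GRing.isMonoidMorphism.Build La A phi (phi1, phiM)).
have phi_iota : phi \o iota1 =1 j.
  apply: (malg_linear_ext (f := phi \o iota1)) => x /=.
  have e : [fset x] = [fset y in [:: x]] :> {fset B}.
    by apply/fsetP => y; rewrite !inE orbF.
  rewrite /iota1 lextU e; have := phiS [:: x] isT.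
  by rewrite big_seq1 => h; exact: h.
exists phiR => // psi psij x; rewrite (malg_expand x) !linear_sum.
apply: eq_bigr => E _; rewrite [LHS]linearZ [RHS]linearZ; congr (_ *: _).
rewrite -extbE /extb rmorph_prod (rmorph_prod phiR).
by apply: eq_bigr => e _; rewrite [LHS]psij [RHS]phi_iota.
Qed.

End Exterior.

Arguments iota1 {F d B}.

(* The tensor square of the exterior algebra. *)
Notation extsq F B := {malg F[({fset B} * {fset B})%type]}.

Section Lambda.
Variables (F : fieldType) (d : Order.disp_t) (B : orderType d).
Local Notation La := (extalg F B).
Local Notation V := {malg F[B]}.
Local Notation VV := {malg F[(B * B)%type]}.
Local Notation LaLa := (extsq F B).

Definition nabla : LaLa -> La :=
  lext (fun k => (<< k.1 >> : La) * (<< k.2 >> : La)).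
HB.instance Definition _ := GRing.Linear.on nabla.

Lemma nablaE (x y : La) : nabla (x \ot y) = x * y.
Proof.
have bl y' : linear (fun x : La => x * y').
  by move=> a u v; rewrite mulrDl -scalerAl.
have br (x' : La) : linear ( *%R x').
  by move=> a u v; rewrite mulrDr -scalerAr.
have [h hP _] := tensor_univ bl br.
rewrite -hP; apply: malg_linear_ext => -[E G].
by rewrite -[in RHS]tensorU hP; exact: lextU.
Qed.

Definition proj (k : nat) : La -> La :=
  lext (fun E : {fset B} => if #|` E| == k then extb F E else 0).
HB.instance Definition _ k := GRing.Linear.on (proj k).

Definition tau (p : F) : VV -> VV :=
  lext (fun k => let: (a, b) := k in
    if a == b then - << (a, b) >>
    else if (b < a)%O then - ((1 - p) *: << (a, b) >>) - << (b, a) >>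
    else - (p *: << (b, a) >>)).
HB.instance Definition _ p := GRing.Linear.on (tau p).

(* These conditions determine a linear tauh. In the last one the two factors of
   the fourfold tensor power LaLa (x) LaLa are (1st, 2nd) and (3rd, 4th). *)
Definition is_braiding (p : F) (tauh : LaLa -> LaLa) : Prop :=
  [/\ forall t : VV, tauh ((iota1 \otm iota1) t) =
                     (iota1 \otm iota1) (tau p t),
      forall x : La, tauh ((1 : La) \ot x) = x \ot (1 : La),
      forall x : La, tauh (x \ot (1 : La)) = (1 : La) \ot x &
      tauh \o (nabla \otm nabla) =1
        (nabla \otm nabla) \o mid tauh \o (tauh \otm tauh) \o mid tauh].

(* These conditions determine a linear Delta. *)
Definition is_coproduct (tauh : LaLa -> LaLa) (Delta : La -> LaLa) : Prop :=
  [/\ Delta 1 = (1 : La) \ot (1 : La),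
      forall v : V, Delta (iota1 v) =
        iota1 v \ot (1 : La) + (1 : La) \ot iota1 v &
      Delta \o nabla =1 (nabla \otm nabla) \o mid tauh \o (Delta \otm Delta)].

Section Coproduct.
Variable Delta : La -> LaLa.

(* Delta_{k)} = Delta_l k and Delta_{(k} = Delta_r k. *)
Definition Delta_l (k : nat) : La -> LaLa := (proj k \otm id) \o Delta.
Definition Delta_r (k : nat) : La -> LaLa := (id \otm proj k) \o Delta.

Definition opL : LaLa -> LaLa :=
  (nabla \otm id) \o assocl \o (id \otm Delta_l 1).
Definition opR : LaLa -> LaLa :=
  (id \otm nabla) \o assocr \o (Delta_r 1 \otm id).

End Coproduct.

Definition gamma (p : F) (k : nat) : F := (-1) ^+ k * p ^+ (k * k.-1)./2.

Definition qnum (p : F) (n : nat) : F := \sum_(i < n) p ^+ i.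

Definition qfact (p : F) (n : nat) : F := \prod_(1 <= i < n.+1) qnum p i.

(* The p-divided power x^<n> = x^n / [n]_p^! of an endomorphism x. *)
Definition qdivpow (p : F) (n : nat) (x : LaLa -> LaLa) : LaLa -> LaLa :=
  fun t => (qfact p n)^-1 *: iter n x t.

End Lambda.

Arguments nabla {F d B}.
Arguments proj {F d B}.

(* Main.v *)
(* In a braided Hopf algebra with antipode S one has, in Sweedler notation,
   S(x_1) (x_2 y)_1 (x) (x_2 y)_2 = tauh(x (x) y_1) y_2, by expanding Delta on
   the product x_2 y and cancelling S(x_1) x_2.  Since tauh exchanges degrees,
   the part of this identity whose left factor has the degree of y is exactly
   tauh(x (x) y).  Here Delta f_E is the sum over S of
   (-p)^inv(S, E - S) f_S (x) f_{E - S}, from which coassociativity is read off,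
   S is multiplication by gamma_k in degree k, because the sum over S of
   gamma_|S| p^inv(S, E - S) telescopes to 0 when E is nonempty, and
   L^<j>, R^<j> are the operators built from Delta_{j)} and Delta_{(j}, because
   the sum of p^inv(S, E - S) over the S with |S| = 1, or with |E - S| = 1, is
   [|E|]_p. *)

Require Import Defs.
From HB Require Import structures.
From mathcomp Require Import all_boot all_order all_algebra.
From mathcomp Require Import finmap.
From mathcomp.multinomials Require Import monalg.
From mathcomp Require Import zify.
Import Order.TTheory GRing.Theory.
Local Open Scope ring_scope.

Set Implicit Arguments.
Unset Strict Implicit.
Unset Printing Implicit Defensive.

(** * Sums over the subsets of a finite set *)

Section Subsets.
Local Open Scope fset_scope.
Local Open Scope ring_scope.
Variable K : choiceType.
Implicit Types A E S T U : {fset K}.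

Lemma fsetUDK S U : S `<=` U -> S `|` (U `\` S) = U.
Proof. by move/fsetIidPr => {1}<-; rewrite fsetID. Qed.

Lemma big_fpowersetU1 (V : nmodType) e E (f : {fset K} -> V) : e \notin E ->
  \sum_(S <- fpowerset (e |` E)) f S =
  \sum_(S <- fpowerset E) f S + \sum_(S <- fpowerset E) f (e |` S).
Proof.
move=> eE.
have sE S : S \in fpowerset E -> e \notin S.
  by rewrite fpowersetE => /fsubsetP sE; apply: contra eE => /sE.
rewrite -(big_map (fun S => e |` S) xpredT f) -big_cat /=; apply: perm_big.
apply: uniq_perm; first exact: fset_uniq.
  rewrite cat_uniq fset_uniq map_inj_in_uniq ?fset_uniq ?andbT /=.
    by apply/hasPn => _ /mapP[S _ ->]; apply/negP => /sE; rewrite fset1U1.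
  by move=> S T /sE eS /sE eT /(congr1 (fun A => A `\ e)); rewrite !fsetU1K.
move=> S; rewrite mem_cat fpowersetE; apply/idP/orP => [sS|].
  case: (boolP (e \in S)) => eS; [right|left].
    apply/mapP; exists (S `\ e); last by rewrite fsetD1K.
    by rewrite fpowersetE fsubDset.
  rewrite fpowersetE; apply/fsubsetP => x xS.
  move/fsubsetP/(_ x xS): sS; rewrite in_fset1U => /orP[/eqP xe|//].
  by rewrite -xe xS in eS.
case=> [|/mapP[T]]; rewrite fpowersetE => sT.
  exact: fsubset_trans (fsubsetU1 _ _).
by move->; apply: fsetUS.
Qed.

(** The substitution U = S u T, with inverse T = U - S. *)
Lemma big_fpowersetD (V : nmodType) S E (f : {fset K} -> V) : S `<=` E ->
  \sum_(T <- fpowerset (E `\` S)) f T =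
  \sum_(U <- fpowerset E | S `<=` U) f (U `\` S).
Proof.
move=> sSE; rewrite -[RHS]big_filter.
rewrite -[RHS](big_map (fun U => U `\` S) xpredT f).
apply: perm_big; apply: uniq_perm; first exact: fset_uniq.
  rewrite map_inj_in_uniq ?filter_uniq ?fset_uniq //.
  move=> U U'; rewrite !mem_filter => /andP[sU _] /andP[sU' _] eqUU'.
  by rewrite -(fsetUDK sU) eqUU' fsetUDK.
move=> T; rewrite fpowersetE; apply/idP/mapP => [|[U]].
  rewrite fsubsetD => /andP[sT dT]; exists (S `|` T).
    by rewrite mem_filter fsubsetUl fpowersetE fsubUset sSE.
  by rewrite fsetDUl fsetDv fset0U; apply/esym/fsetDidPl.
by rewrite mem_filter fpowersetE => /andP[_ sU] ->; apply: fsetSD.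
Qed.

(** Both sides run over the ordered partitions of E into three blocks; on the right U is the union
    of the first two. This is the combinatorial content of the coassociativity of [Delta]. *)
Lemma fpowerset_coassoc (V : nmodType) E
    (f : {fset K} -> {fset K} -> {fset K} -> V) :
  \sum_(S <- fpowerset E) \sum_(T <- fpowerset (E `\` S))
     f S T (E `\` S `\` T) =
  \sum_(U <- fpowerset E) \sum_(S <- fpowerset U) f S (U `\` S) (E `\` U).
Proof.
transitivity (\sum_(S <- fpowerset E) \sum_(U <- fpowerset E | S `<=` U)
   f S (U `\` S) (E `\` U)).
  apply: eq_big_seq => S; rewrite fpowersetE => sS.
  rewrite (big_fpowersetD (fun T => f S T _) sS).
  by apply: eq_bigr => U sU; rewrite fsetDDl fsetUDK.
rewrite (exchange_big_dep xpredT) //=; apply: eq_big_seq => U.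
rewrite fpowersetE => sU; rewrite -[LHS]big_filter; apply: perm_big.
apply: uniq_perm; rewrite ?filter_uniq ?fset_uniq // => S.
rewrite mem_filter !fpowersetE; case: (boolP (S `<=` U)) => //= sSU.
exact: fsubset_trans sU.
Qed.

Lemma big_fset_pred1 (V : nmodType) (X : {fset K}) (a : K)
    (f : K -> V) :
  a \in X -> \sum_(i <- X | i == a) f i = f a.
Proof.
move=> aX; rewrite big_mkcond (bigD1_seq a) ?fset_uniq //= eqxx big1 ?addr0 //.
by move=> i /negPf->.
Qed.

End Subsets.

(** * Inversions between disjoint finite sets *)

Section Inversions.
Local Open Scope fset_scope.
Local Open Scope ring_scope.
Variables (d : Order.disp_t) (B : orderType d).
Implicit Types (e : B) (E S T U : {fset B}).

(** Adjoining a new minimum e is convenient because e forms no inversion when it stands on the left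
    and one with every element when it stands on the right, and because f_e f_E is the basis vector
    of the union without a sign. *)
Lemma fset_min_ind (P : {fset B} -> Prop) : P fset0 ->
  (forall e E, (forall x, x \in E -> (e < x)%O) -> P E -> P (e |` E)) ->
  forall E, P E.
Proof.
move=> P0 PU E; have [s ss ->] : exists2 s, sorted <%O s & E = [fset x in s].
  exists (sort <=%O (enum_fset E)); first by rewrite sort_lt_sorted fset_uniq.
  by apply/fsetP => x; rewrite !inE mem_sort.
elim: s ss => [|e s IHs].
  move=> _; suff -> : [fset x in [::]] = fset0 :> {fset B} by [].
  by apply/fsetP=> x; rewrite !inE.
rewrite /= lt_path_sortedE => /andP[/allP es ss].
rewrite (_ : [fset x in e :: s] = e |` [fset x in s]); last first.
  by apply/fsetP => x; rewrite !inE.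
by apply: PU (IHs _) => // x; rewrite !inE => /es.
Qed.

Lemma big_fsetU_disjoint E G (f : B -> nat) : [disjoint E & G] ->
  (\sum_(x <- E `|` G) f x = \sum_(x <- E) f x + \sum_(x <- G) f x)%N.
Proof.
move=> dEG; rewrite -big_cat /=; apply/perm_big/uniq_perm.
- exact: fset_uniq.
- rewrite cat_uniq !fset_uniq andbT /=; apply/hasPn => x xG.
  by apply: contraTN xG => /(fdisjointP dEG).
- by move=> x; rewrite mem_cat in_fsetU.
Qed.

Lemma inversionsUr E G H : [disjoint G & H] ->
  inversions E (G `|` H) = (inversions E G + inversions E H)%N.
Proof.
move=> dGH; rewrite /inversions -big_split; apply: eq_bigr => x _ /=.
by rewrite big_fsetU_disjoint.
Qed.

Lemma inversionsUl E G H : [disjoint E & G] ->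
  inversions (E `|` G) H = (inversions E H + inversions G H)%N.
Proof. by move=> dEG; rewrite /inversions big_fsetU_disjoint. Qed.

Lemma inversions0l E : inversions fset0 E = 0%N.
Proof. by rewrite /inversions big_seq_fset0. Qed.

Lemma inversions0r E : inversions E fset0 = 0%N.
Proof. by rewrite /inversions big1 // => x _; rewrite big_seq_fset0. Qed.

Lemma inversions_minl e E : (forall x, x \in E -> (e < x)%O) ->
  inversions [fset e] E = 0%N.
Proof.
move=> eE; rewrite /inversions big_seq_fset1 big_seq big1 // => x /eE.
by move/lt_gtF->.
Qed.

Lemma inversions_minr e E : (forall x, x \in E -> (e < x)%O) ->
  inversions E [fset e] = #|` E|.
Proof.
move=> eE; rewrite /inversions big_seq.
rewrite (eq_bigr (fun=> 1%N)) => [|x /eE ex]; last by rewrite big_seq_fset1 ex.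
by rewrite -big_seq big_const_seq count_predT iter_addn addn0 mul1n.
Qed.

(** With the blocks S, T = U - S and R = E - U, both sides equal inv(S, T) + inv(S, R) + inv(T,
    R). *)
Lemma inversions_coassoc E U S : S `<=` U -> U `<=` E ->
  (inversions S (E `\` S) + inversions (U `\` S) (E `\` U) =
   inversions U (E `\` U) + inversions S (U `\` S))%N.
Proof.
move=> sSU sUE.
have -> : E `\` S = (U `\` S) `|` (E `\` U).
  apply/fsetP => x; rewrite !inE; have := fsubsetP sSU x.
  have := fsubsetP sUE x.
  by case: (x \in S); case: (x \in U); case: (x \in E) => // h1 h2; auto.
have dU : [disjoint U `\` S & E `\` U].
  by apply/fdisjointP => x; rewrite !inE => /andP[_ ->].
have dS : [disjoint S & U `\` S].
  by apply/fdisjointP => x xS; rewrite !inE xS.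
rewrite (inversionsUr _ dU).
rewrite -[in inversions U _](fsetUDK sSU) (inversionsUl _ dS) (fsetUDK sSU).
lia.
Qed.

Lemma fsetU1D_min e E S : (forall x, x \in E -> (e < x)%O) -> S `<=` E ->
  (e |` E) `\` S = e |` (E `\` S).
Proof.
move=> eE sSE; apply/fsetP => x; rewrite !inE; have [->|] //= := eqVneq x e.
by rewrite andbT; apply/negP => /(fsubsetP sSE)/eE; rewrite ltxx.
Qed.

Lemma fsetU1DU1_min e E S : (forall x, x \in E -> (e < x)%O) ->
  (e |` E) `\` (e |` S) = E `\` S.
Proof.
move=> eE; apply/fsetP => x; rewrite !inE; have [->|] //= := eqVneq x e.
by apply/esym/negP => /andP[_ /eE]; rewrite ltxx.
Qed.

Lemma notin_min e E S : (forall x, x \in E -> (e < x)%O) -> S `<=` E ->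
  e \notin S.
Proof. by move=> eE /fsubsetP sSE; apply/negP => /sSE/eE; rewrite ltxx. Qed.

Lemma inversions_setU1r e E S : (forall x, x \in E -> (e < x)%O) ->
  S `<=` E ->
  inversions S ((e |` E) `\` S) = (#|` S| + inversions S (E `\` S))%N.
Proof.
move=> eE sSE; rewrite fsetU1D_min // inversionsUr.
  by rewrite inversions_minr // => x /(fsubsetP sSE)/eE.
by rewrite fdisjoint1X (notin_min eE) // fsubsetDl.
Qed.

Lemma inversions_setU1l e E S : (forall x, x \in E -> (e < x)%O) ->
  S `<=` E ->
  inversions (e |` S) ((e |` E) `\` (e |` S)) = inversions S (E `\` S).
Proof.
move=> eE sSE; rewrite fsetU1DU1_min // inversionsUl; last first.
  by rewrite fdisjoint1X (notin_min eE).
by rewrite inversions_minl // => x; rewrite inE => /andP[_ /eE].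
Qed.

Lemma big_fpowerset_card0 (V : nmodType) E (f : {fset B} -> V) :
  \sum_(S <- fpowerset E | #|` S| == 0%N) f S = f fset0.
Proof.
rewrite (eq_bigl (pred1 fset0)) => [|S]; last by rewrite cardfs_eq0.
by rewrite big_fset_pred1 // fpowersetE fsub0set.
Qed.

Lemma big_fpowerset_cardD0 (V : nmodType) E (f : {fset B} -> V) :
  \sum_(S <- fpowerset E | #|` E `\` S| == 0%N) f S = f E.
Proof.
rewrite big_seq_cond (eq_bigl (fun S => (S \in fpowerset E) && (S == E))).
  by rewrite -big_seq_cond big_fset_pred1 // fpowersetE fsubset_refl.
move=> S; rewrite fpowersetE cardfs_eq0 fsetD_eq0 eqEfsubset.
by case: (S `<=` E).
Qed.

(** * Sums of powers of p weighted by inversions *)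

Variables (F : fieldType) (p : F).

Lemma qnumS n : qnum p n.+1 = 1 + p * qnum p n.
Proof.
rewrite /qnum big_ord_recl mulr_sumr; congr (_ + _).
by apply: eq_bigr => i _; rewrite exprS.
Qed.

(** The exponent of p in [gamma] is a binomial coefficient, and Pascal's rule gives 'C(n+1, 2) =
    'C(n, 2) + n. *)
Lemma gammaS n : gamma p n.+1 = - (p ^+ n * gamma p n).
Proof.
rewrite /gamma -!bin2 binS bin1 addnC exprD exprS !mulN1r !mulNr mulrCA.
by rewrite mulrA.
Qed.

(** For S = {x} the exponent is the number of elements of E below x, so it takes each value from 0
    to |E| - 1 once. In the induction the new minimum contributes 1 and raises every other exponent
    by 1. *)
Lemma sum_inversions_card1 E :
  \sum_(S <- fpowerset E | #|` S| == 1%N) p ^+ inversions S (E `\` S) =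
  qnum p #|` E|.
Proof.
elim/fset_min_ind: E => [|e E eE IHE].
  rewrite fpowerset0 cardfs0 /qnum big_ord0 big_mkcond big_seq_fset1.
  by rewrite cardfs0.
have eNE := notin_min eE (fsubset_refl E).
rewrite cardfsU1 eNE qnumS -IHE addrC big_mkcond big_fpowersetU1 //.
congr (_ + _).
  rewrite mulr_sumr [RHS]big_mkcond; apply: eq_big_seq => S.
  rewrite fpowersetE => sSE; case: eqP => // S1.
  by rewrite inversions_setU1r // S1 exprS.
transitivity (\sum_(S <- fpowerset E | #|` S| == 0%N)
  p ^+ inversions S (E `\` S)); last first.
  by rewrite big_fpowerset_card0 inversions0l.
rewrite [RHS]big_mkcond; apply: eq_big_seq => S; rewrite fpowersetE => sSE.
by rewrite cardfsU1 (notin_min eE) //= inversions_setU1l.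
Qed.

(** For E - S = {y} the exponent is the number of elements of E above y. A new minimum now
    contributes the top power of p and leaves the other exponents unchanged. *)
Lemma sum_inversions_cardD1 E :
  \sum_(S <- fpowerset E | #|` E `\` S| == 1%N) p ^+ inversions S (E `\` S) =
  qnum p #|` E|.
Proof.
elim/fset_min_ind: E => [|e E eE IHE].
  rewrite fpowerset0 cardfs0 /qnum big_ord0 big_mkcond big_seq_fset1.
  by rewrite fsetDv cardfs0.
have eNE := notin_min eE (fsubset_refl E).
rewrite cardfsU1 eNE /qnum big_ord_recr -/(qnum _ _) -IHE [RHS]addrC.
rewrite big_mkcond big_fpowersetU1 //; congr (_ + _).
  transitivity (\sum_(S <- fpowerset E | #|` E `\` S| == 0%N)
    p ^+ (#|` S| + inversions S (E `\` S))); last first.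
    by rewrite big_fpowerset_cardD0 fsetDv inversions0r addn0.
  rewrite [RHS]big_mkcond; apply: eq_big_seq => S; rewrite fpowersetE => sSE.
  rewrite inversions_setU1r // fsetU1D_min // cardfsU1 (notin_min eE) //.
  exact: fsubsetDl.
rewrite [RHS]big_mkcond; apply: eq_big_seq => S; rewrite fpowersetE => sSE.
by rewrite inversions_setU1l // fsetU1DU1_min.
Qed.

(** Let e be the minimum of a nonempty set and pair each S without e with e |[S. The inversions of S
    with its complement exceed those of e |] S by |S|, which [gammaS] compensates with the opposite
    sign, so the two terms cancel. This is the antipode identity. *)
Lemma sum_gamma_inversions E :
  \sum_(S <- fpowerset E) gamma p #|` S| * p ^+ inversions S (E `\` S) =
  (E == fset0)%:R.
Proof.
elim/fset_min_ind: E => [|e E eE _].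
  rewrite fpowerset0 big_seq_fset1 cardfs0 inversions0l /gamma eqxx !expr0.
  by rewrite !mulr1.
have eNE := notin_min eE (fsubset_refl E).
rewrite big_fpowersetU1 // -big_split big_seq big1 => [|S].
  by case: eqP => // /fsetP/(_ e); rewrite !inE eqxx.
rewrite fpowersetE => sSE; rewrite inversions_setU1l // inversions_setU1r //.
rewrite cardfsU1 (notin_min eE) // gammaS exprD mulNr.
by rewrite [_ * gamma _ _]mulrC -[X in - X]mulrA; exact: addrN.
Qed.

End Inversions.

(** * The braiding formula over abstract data *)

(* A, W and tens stand for the exterior algebra, its tensor square and the
   tensor product, and v E for f_E. They are abstract because, with {malg F[_]}
   in their place, failing unifications unfold the structures and rewriting
   becomes very slow. *)
Section BraidedExterior.
Local Open Scope fset_scope.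
Local Open Scope ring_scope.
Variables (F : fieldType) (d : Order.disp_t) (B : orderType d) (p : F).
Variables (A : algType F) (W : lmodType F) (v : {fset B} -> A).
Variables (tens : A -> {linear A -> W}) (tensl : A -> {linear A -> W}).
Local Notation w E G := (tens (v E) (v G)).
Local Notation c S T := ((- p) ^+ inversions S T).
Implicit Types (e : B) (E S T U G H : {fset B}).

(* tensl records the linearity of tens in its first argument. *)
Hypothesis tenslE : forall x y, tensl y x = tens x y.
Hypothesis tens_ind : forall P : W -> Prop,
  P 0 -> (forall a s t, P s -> P t -> P (a *: s + t)) ->
  (forall S T, P (w S T)) -> forall t, P t.
Hypothesis v0 : v fset0 = 1.
Hypothesis vM : forall E G, v E * v G =
  if [disjoint E & G]%fset then (-1) ^+ inversions E G *: v (E `|` G) else 0.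

Lemma tens_eq (f g : {linear W -> W}) :
  (forall S T, f (w S T) = g (w S T)) -> f =1 g.
Proof.
move=> fg; apply: tens_ind => [|a s t fs ft|S T]; rewrite ?linear0 //.
by rewrite !linearP fs ft.
Qed.

(** Reduces the form of the theorem with projections to basis tensors; [q] will be the projection
    onto one bidegree. *)
Lemma tens_eq_sum (f q : {linear W -> W}) (r : seq nat) (a : nat -> F)
    (g h : nat -> {linear W -> W}) :
  (forall S T, f (q (w S T)) = \sum_(k <- r) a k *: g k (h k (q (w S T)))) ->
  forall t, f (q t) = \sum_(k <- r) a k *: g k (h k (q t)).
Proof.
move=> fq; apply: tens_ind => // [|b s t fs ft].
  by rewrite !linear0 big1 // => k _; rewrite !linear0 ?scaler0.
rewrite !linearP fs ft scaler_sumr -big_split; apply: eq_bigr => k _.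
by rewrite !linearP ?scalerDr !scalerA mulrC.
Qed.

Lemma v_min e E : (forall x, x \in E -> (e < x)%O) ->
  v [fset e] * v E = v (e |` E).
Proof.
move=> eE; rewrite vM fdisjoint1X (notin_min eE (fsubset_refl E)).
by rewrite inversions_minl // scale1r.
Qed.

Lemma v_setD S U : S `<=` U ->
  v S * v (U `\` S) = (-1) ^+ inversions S (U `\` S) *: v U.
Proof.
move=> sSU; rewrite vM fsetUDK // ifT //.
by apply/fdisjointP => x xS; rewrite !inE xS.
Qed.

(** * The part of bidegree (i, j), as an inductively generated span *)

Inductive homog (i j : nat) : W -> Prop :=
| homog0 : homog i j 0
| homogP a s t : homog i j s -> homog i j t -> homog i j (a *: s + t)
| homog_tens S T : #|` S| = i -> #|` T| = j -> homog i j (w S T).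

Lemma homogZ i j a t : homog i j t -> homog i j (a *: t).
Proof.
by move=> ht; rewrite -[_ *: _]addr0; apply: homogP => //; exact: homog0.
Qed.

Lemma homogD i j s t : homog i j s -> homog i j t -> homog i j (s + t).
Proof. by move=> hs ht; rewrite -[s]scale1r; exact: homogP. Qed.

Lemma homogN i j t : homog i j t -> homog i j (- t).
Proof. by rewrite -scaleN1r; apply: homogZ. Qed.

Lemma homogU S T : homog #|` S| #|` T| (w S T).
Proof. exact: homog_tens. Qed.

Lemma homog_linear i j k l (f : {linear W -> W}) t : homog i j t ->
  (forall S T, #|` S| = i -> #|` T| = j -> homog k l (f (w S T))) ->
  homog k l (f t).
Proof.
move=> + hf; elim=> [|a s s' _ IHs _ IHs'|S T Si Tj]; last exact: hf.
  by rewrite linear0; apply: homog0.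
by rewrite linearP; apply: homogP.
Qed.

Variables (lmul rmul : A -> {linear W -> W}).
Hypothesis lmulT : forall x y z, lmul x (tens y z) = tens (x * y) z.
Hypothesis rmulT : forall x y z, rmul x (tens y z) = tens y (z * x).
(** [ext] plays the role of Sweedler notation: [ext h (Delta x)] is the sum of h(x_1, x_2), with h
    extended bilinearly from the basis. *)
Variable ext : ({fset B} -> {fset B} -> W) -> {linear W -> W}.
Hypothesis extT : forall h S T, ext h (w S T) = h S T.
Variable pl : nat -> {linear W -> W}.
Hypothesis plT : forall n S T,
  pl n (w S T) = if #|` S| == n then w S T else 0.

Lemma homog_lmul k i j S t : #|` S| = k ->
  homog i j t -> homog (k + i) j (lmul (v S) t).
Proof.
move=> Sk ht; apply: (homog_linear ht) => T U Ti Uj.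
rewrite lmulT vM; case: ifP => dST; last first.
  by rewrite -tenslE linear0; apply: homog0.
rewrite -tenslE linearZ /= tenslE; apply: homogZ.
apply: homog_tens => //; rewrite -Sk -Ti.
by rewrite cardfsU (eqP dST) cardfs0 subn0.
Qed.

Lemma homog_rmul k i j S t : #|` S| = k ->
  homog i j t -> homog i (j + k) (rmul (v S) t).
Proof.
move=> Sk ht; apply: (homog_linear ht) => T U Ti Uj.
rewrite rmulT vM; case: ifP => dST; last first.
  by rewrite linear0; apply: homog0.
rewrite linearZ /=; apply: homogZ.
apply: homog_tens => //; rewrite -Sk -Uj.
by rewrite cardfsU (eqP dST) cardfs0 subn0.
Qed.

Lemma lmul1 t : lmul 1 t = t.
Proof.
by apply: (tens_eq (f := lmul 1) (g := idfun)) => S T; rewrite lmulT mul1r.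
Qed.

Lemma rmul1 t : rmul 1 t = t.
Proof.
by apply: (tens_eq (f := rmul 1) (g := idfun)) => S T; rewrite rmulT mulr1.
Qed.

Lemma lmulM x y t : lmul x (lmul y t) = lmul (x * y) t.
Proof.
apply: (tens_eq (f := lmul x \o lmul y) (g := lmul (x * y))) => S T /=.
by rewrite !lmulT mulrA.
Qed.

Lemma lmulZ a x t : lmul (a *: x) t = a *: lmul x t.
Proof.
move: t; apply: tens_ind => [|b s t IHs IHt|S T].
- by rewrite !linear0 ?scaler0.
- by rewrite !linearP IHs IHt ?scalerDr !scalerA mulrC.
by rewrite !lmulT -scalerAl -!tenslE linearZ.
Qed.

Lemma pl_homog n i j t : homog i j t -> pl n t = if i == n then t else 0.
Proof.
elim=> [|a s s' _ IHs _ IHt|S T <- _].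
- by rewrite linear0; case: ifP.
- by rewrite linearP IHs IHt; case: ifP => _; rewrite ?scaler0 ?addr0.
exact: plT.
Qed.

(** Multiplication by f_S raises the left degree by |S|. The test guards against the truncation of n
    - |S| to 0. *)
Lemma pl_lmul n S t : pl n (lmul (v S) t) =
  if (#|` S| <= n)%N then lmul (v S) (pl (n - #|` S|) t) else 0.
Proof.
move: t; apply: tens_ind => [|a s t IHs IHt|T U].
- by rewrite !linear0; case: ifP.
- by rewrite !linearP IHs IHt; case: ifP => _; rewrite ?scaler0 ?addr0.
have /pl_homog-> : homog (#|` S| + #|` T|) #|` U| (lmul (v S) (w T U)).
  by apply: homog_lmul => //; apply: homogU.
rewrite plT; case: leqP => [leSn|ltnS].
  by rewrite -(eqn_add2l #|` S| #|` T|) subnKC //; case: ifP; rewrite ?linear0.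
by rewrite gtn_eqF // ltn_addr.
Qed.

(** * The braiding on basis tensors *)

Variable tauh : {linear W -> W}.
Hypothesis tauh0l : forall E, tauh (w fset0 E) = w E fset0.
Hypothesis tauh0r : forall E, tauh (w E fset0) = w fset0 E.
Hypothesis tauh11 : forall a b : B, tauh (w [fset a] [fset b]) =
  if a == b then - w [fset a] [fset b]
  else if (b < a)%O
  then - ((1 - p) *: w [fset a] [fset b]) - w [fset b] [fset a]
  else - (p *: w [fset b] [fset a]).
(** [hexagonr] and [hexagonl] are the compatibility of the braiding with the product, taken in one
    argument at a time. *)
Hypothesis hexagonr : forall E G H, tauh (tens (v E) (v G * v H)) =
  ext (fun S T => lmul (v S) (tauh (w T H))) (tauh (w E G)).
Hypothesis hexagonl : forall E G H, tauh (tens (v E * v G) (v H)) =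
  ext (fun S T => rmul (v T) (tauh (w E S))) (tauh (w G H)).

(** Moving e past a larger element only produces the factor -p; the term of [tau] with 1 - p does
    not arise. [hexagonr] moves e past the elements of S one by one. *)
Lemma tauh_min e S : (forall x, x \in S -> (e < x)%O) ->
  tauh (w [fset e] S) = (- p) ^+ #|` S| *: w S [fset e].
Proof.
elim/fset_min_ind: S => [|x S xS IHS] eS.
  by rewrite tauh0r cardfs0 scale1r.
have ex : (e < x)%O by apply: eS; rewrite fset1U1.
rewrite -(v_min xS) hexagonr tauh11 (lt_eqF ex) (lt_gtF ex).
rewrite -scaleNr linearZ /= extT IHS; last first.
  by move=> y yS; apply: eS; rewrite fset1Ur.
rewrite linearZ /= lmulT (v_min xS) scalerA.
by rewrite cardfsU1 (notin_min xS (fsubset_refl S)) exprS.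
Qed.

(** The braiding exchanges degrees because [tau] preserves the bidegree (1, 1). [hexagonr] carries
    this to a singleton against any set, and [hexagonl] then to any pair. *)
Lemma tauh_homog E G : homog #|` G| #|` E| (tauh (w E G)).
Proof.
have h1 e : forall H, homog #|` H| 1 (tauh (w [fset e] H)).
  move=> H; elim/fset_min_ind: H e => [|x H xH IHH] e.
    by rewrite tauh0r -(cardfs1 e); apply: homogU.
  rewrite -(v_min xH) hexagonr cardfsU1 (notin_min xH (fsubset_refl H)).
  have hT : homog 1 1 (tauh (w [fset e] [fset x])).
    have hU y z : homog 1 1 (w [fset y] [fset z]).
      by apply: homog_tens; rewrite cardfs1.
    rewrite tauh11; case: ifP => _; first exact/homogN/hU.
    case: ifP => _; last exact/homogN/homogZ/hU.
    by apply: homogD; [apply/homogN/homogZ/hU|apply/homogN/hU].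
  apply: (homog_linear hT) => S T S1 /eqP/cardfs1P[y ->].
  by rewrite extT; apply: homog_lmul.
elim/fset_min_ind: E G => [|e E eE IHE] G.
  by rewrite tauh0l; apply: homogU.
rewrite -(v_min eE) hexagonl cardfsU1 (notin_min eE (fsubset_refl E)).
apply: (homog_linear (IHE G)) => S T SG TE; rewrite extT -SG.
exact: homog_rmul TE (h1 e S).
Qed.

(** * The coproduct and the braiding formula *)

Variable Delta : {linear A -> W}.
Hypothesis Delta1 : Delta 1 = tens 1 1.
Hypothesis Delta_prim : forall e, Delta (v [fset e]) =
  w [fset e] fset0 + w fset0 [fset e].
(** In Sweedler notation, Delta(x y) = x_1 tauh(x_2 (x) y_1) y_2. *)
Hypothesis DeltaM : forall S T, Delta (v S * v T) =
  ext (fun S1 S2 => lmul (v S1)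
    (ext (fun T1 T2 => rmul (v T2) (tauh (w S2 T1))) (Delta (v T))))
    (Delta (v S)).

(** For a new minimum e, the summand e (x) 1 of Delta e yields the subsets that contain e. The
    summand 1 (x) e yields the others, where e has to pass f_S at the cost of (-p)^|S| by
    [tauh_min], matching the |S| new inversions. *)
Lemma DeltaE E : Delta (v E) =
  \sum_(S <- fpowerset E) c S (E `\` S) *: w S (E `\` S).
Proof.
elim/fset_min_ind: E => [|e E eE IHE].
  rewrite fpowerset0 big_seq_fset1 fsetD0 inversions0l expr0 scale1r.
  by rewrite v0 Delta1.
have eNE := notin_min eE (fsubset_refl E).
rewrite -{1}(v_min eE) DeltaM Delta_prim linearD /= !extT v0 lmul1 IHE.
rewrite big_fpowersetU1 // addrC !linear_sum /=; congr (_ + _).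
  apply: eq_big_seq => S; rewrite fpowersetE => sSE.
  rewrite linearZ /= extT tauh_min; last by move=> x /(fsubsetP sSE)/eE.
  rewrite linearZ /= rmulT v_min; last by move=> x; rewrite inE => /andP[_ /eE].
  by rewrite scalerA -exprD addnC inversions_setU1r // fsetU1D_min.
apply: eq_big_seq => S; rewrite fpowersetE => sSE.
rewrite !linearZ /= extT -v0 tauh0l rmulT v0 mul1r lmulT v_min.
  by rewrite inversions_setU1l // fsetU1DU1_min.
by move=> x /(fsubsetP sSE)/eE.
Qed.

(** This is the braiding formula with the operator built from Delta_{(j} already expanded over the
    subsets S of E. *)
Lemma tauhE E G : tauh (w E G) =
  \sum_(0 <= k < (minn #|` E| #|` G|).+1) gamma p k *:
    (\sum_(S <- fpowerset E | #|` E `\` S| == (#|` E| - k)%N)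
       c S (E `\` S) *:
         lmul (v S) (pl (#|` G| - k) (Delta (v (E `\` S) * v G)))).
Proof.
pose X U := ext (fun T1 T2 => rmul (v T2) (tauh (w U T1))) (Delta (v G)).
(* X U is tauh (f_U (x) y_1) y_2 for y = f_G. *)
transitivity (pl #|` G| (X E)).
  rewrite /X DeltaE !linear_sum /= (bigD1_seq G) ?fset_uniq //=; last first.
    by rewrite fpowersetE fsubset_refl.
  rewrite !linearZ /= extT fsetDv v0 rmul1 inversions0r scale1r.
  rewrite (pl_homog _ (tauh_homog E G)) eqxx big_seq_cond big1 ?addr0 //.
  move=> T /andP[]; rewrite fpowersetE => sTG TG; rewrite !linearZ /= extT.
  rewrite (pl_homog _ (homog_rmul erefl (tauh_homog E T))) ifN ?scaler0 //.
  apply: contra TG => /eqP cTG; rewrite eqEfcard sTG cTG leqnn //.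
(* The sum over k groups the subsets S by k = |S|; those with more elements than G are killed by
   [pl]. *)
transitivity (\sum_(S <- fpowerset E) (gamma p #|` S| * c S (E `\` S)) *:
    pl #|` G| (lmul (v S) (Delta (v (E `\` S) * v G)))); last first.
  under [RHS]eq_bigr => k _ do rewrite scaler_sumr.
  rewrite (exchange_big_dep xpredT) //=; apply: eq_big_seq => S.
  rewrite fpowersetE => sSE; rewrite pl_lmul.
  have cES : #|` E `\` S| = (#|` E| - #|` S|)%N.
    by rewrite cardfsD (fsetIidPr sSE).
  have leSE := fsubset_leq_card sSE.
  (* The bound gives k <= |E|, so the subtraction is not truncated. *)
  have kS k : (k < (minn #|` E| #|` G|).+1)%N ->
      (#|` E `\` S| == #|` E| - k)%N = (k == #|` S|).
    by move=> kl; rewrite cES; apply/eqP/eqP; lia.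
  rewrite big_nat_cond; case: leqP => [leSG|ltGS]; last first.
    rewrite scaler0 big1 // => k /andP[/andP[_ kl]]; rewrite kS // => /eqP.
    by move: kl; lia.
  rewrite (eq_bigl (fun k => (0 <= k < (minn #|` E| #|` G|).+1)%N &&
                             (k == #|` S|))); last first.
    by move=> k; case: ltnP => //= /kS->.
  rewrite -big_nat_cond big_mkcond (bigD1_seq #|` S|) ?iota_uniq //=;
    last first.
    by rewrite mem_index_iota /= ltnS leq_min leSE.
  rewrite eqxx scalerA big1 ?addr0 // => k /negPf-> //.
transitivity (pl #|` G| (\sum_(S <- fpowerset E)
    (gamma p #|` S| * c S (E `\` S)) *:
      lmul (v S) (Delta (v (E `\` S) * v G)))); last first.
  by rewrite linear_sum; apply: eq_bigr => S _; rewrite linearZ.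
(* It remains to show that tauh(x (x) y_1) y_2 = S(x_1) (x_2 y)_1 (x) (x_2 y)_2. Expanding Delta(x_2
   y) indexes the right side by ordered partitions (S, T, U) of E, with contribution [f S T U]. *)
congr (pl _ _); pose f S T U :=
  (gamma p #|` S| * (c S (E `\` S) * c T U)) *: lmul (v S * v T) (X U).
transitivity (\sum_(S <- fpowerset E) \sum_(T <- fpowerset (E `\` S))
    f S T (E `\` S `\` T)); last first.
  apply: eq_bigr => S _; rewrite DeltaM (DeltaE (E `\` S)) !linear_sum.
  apply: eq_bigr => T _; rewrite [in RHS]linearZ /= extT linearZ /= lmulM.
  by rewrite scalerA -mulrA.
(* Regrouping by the union of the first two blocks, named U from here on, isolates the antipode
   identity on U. *)
rewrite fpowerset_coassoc.
transitivity (\sum_(U <- fpowerset E) (U == fset0)%:R *: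
    (c U (E `\` U) *: lmul (v U) (X (E `\` U)))).
  rewrite (bigD1_seq fset0) ?fset_uniq ?fpowersetE ?fsub0set //=.
  rewrite big1 ?addr0 => [|U /negPf->]; last by rewrite scale0r.
  by rewrite inversions0l !scale1r v0 lmul1 fsetD0.
apply: eq_big_seq => U; rewrite fpowersetE => sUE.
rewrite -(sum_gamma_inversions p) scaler_suml; apply: eq_big_seq => S.
rewrite fpowersetE => sSU; rewrite /f -exprD inversions_coassoc // exprD.
(* The sign from the product of the two basis vectors turns a power of -p into the same power of p,
   as [sum_gamma_inversions] requires. *)
rewrite v_setD // lmulZ !scalerA; congr (_ *: _).
move: (gamma _ _) => g; rewrite -!mulrA -exprMn mulrN1 opprK.
by congr (_ * _); rewrite mulrC.
Qed.

(** * The p-divided powers of L and R *)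

Lemma iter_qfact (X : nat -> {linear W -> W}) :
  (forall S T, X 0%N (w S T) = w S T) ->
  (forall j S T, X 1%N (X j (w S T)) = qnum p j.+1 *: X j.+1 (w S T)) ->
  forall j t, iter j (X 1%N) t = qfact p j *: X j t.
Proof.
move=> X0 XS; elim=> [|j IHj] t.
  rewrite /qfact big_geq // scale1r.
  by rewrite (tens_eq (f := X 0%N) (g := idfun)).
rewrite /qfact big_nat_recr //= -/(qfact _ _) -scalerA IHj linearZ.
congr (_ *: _).
exact: (tens_eq (f := X 1%N \o X j) (g := qnum p j.+1 \*: X j.+1) (XS j) t).
Qed.

Variable pr : nat -> {linear W -> W}.
Hypothesis prT : forall n S T,
  pr n (w S T) = if #|` T| == n then w S T else 0.
(* The p-divided powers of L and R, see iter_Lj and iter_Rj. *)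
Variables Lj Rj : nat -> {linear W -> W}.
Hypothesis LjE : forall j x y, Lj j (tens x y) = lmul x (pl j (Delta y)).
Hypothesis RjE : forall j x y, Rj j (tens x y) = rmul y (pr j (Delta x)).

Lemma RjT j E x : Rj j (tens (v E) x) =
  \sum_(S <- fpowerset E | #|` E `\` S| == j)
    c S (E `\` S) *: tens (v S) (v (E `\` S) * x).
Proof.
rewrite RjE DeltaE !linear_sum [RHS]big_mkcond; apply: eq_bigr => S _.
rewrite !linearZ /= prT; case: ifP => _; first by rewrite rmulT.
by rewrite linear0 scaler0.
Qed.

Lemma LjT j x G : Lj j (tens x (v G)) =
  \sum_(S <- fpowerset G | #|` S| == j)
    c S (G `\` S) *: tens (x * v S) (v (G `\` S)).
Proof.
rewrite LjE DeltaE !linear_sum [RHS]big_mkcond; apply: eq_bigr => S _.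
rewrite !linearZ /= plT; case: ifP => _; first by rewrite lmulT.
by rewrite linear0 scaler0.
Qed.

(** Applying [Rj j] and then [Rj 1] splits E into blocks S, T, U with |T| = 1 and |U| = j. For fixed
    S, f_T f_U is up to sign f_Q with Q = E - S, and the weights of the singletons T in Q add up to
    [j+1]_p. *)
Lemma iter_Rj j t : iter j (Rj 1) t = qfact p j *: Rj j t.
Proof.
move: j t; apply: iter_qfact => [E G|j E G].
  rewrite RjT big_fpowerset_cardD0 fsetDv inversions0r scale1r v0.
  by rewrite mul1r.
pose f S T U := if (#|` T| == 1%N) && (#|` U| == j)
  then (c S (E `\` S) * c T U) *: tens (v S) (v T * v U * v G) else 0.
transitivity (\sum_(U <- fpowerset E) \sum_(S <- fpowerset U)
    f S (U `\` S) (E `\` U)).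
  rewrite RjT linear_sum big_mkcond; apply: eq_big_seq => U.
  rewrite fpowersetE => sUE; rewrite /f; case: eqP => _; last first.
    by rewrite big1 // => S _; rewrite andbF.
  rewrite linearZ /= RjT scaler_sumr big_mkcond; apply: eq_big_seq => S.
  rewrite fpowersetE => sSU; rewrite andbT; case: ifP => // _.
  by rewrite scalerA -!exprD inversions_coassoc // mulrA.
rewrite -fpowerset_coassoc RjT scaler_sumr [RHS]big_mkcond.
apply: eq_big_seq => S _; set Q := E `\` S.
transitivity (\sum_(T <- fpowerset Q | #|` T| == 1%N)
   if #|` Q| == j.+1 then
     p ^+ inversions T (Q `\` T) *: (c S Q *: tens (v S) (v Q * v G)) else 0).
  rewrite [RHS]big_mkcond; apply: eq_big_seq => T.
  rewrite fpowersetE => sTQ; rewrite /f; have [T1|//] := eqP => /=.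
  rewrite cardfsD (fsetIidPr sTQ) T1.
  (* Since Q is not empty, |Q| - 1 = j is equivalent to |Q| = j + 1. *)
  have Q0 : (0 < #|` Q|)%N by rewrite -T1 fsubset_leq_card.
  rewrite -[#|` Q|]prednK // subn1 eqSS /=; case: eqP => // _.
  rewrite v_setD // -!scalerAl linearZ scalerA -mulrA -exprMn mulrN1 opprK.
  by rewrite scalerA mulrC.
case: eqP => [<-|_]; last by rewrite big1.
by rewrite -scaler_suml sum_inversions_card1.
Qed.

(** Mirror image of [iter_Rj]: G is split with |S| = j and |T| = 1, the union U of S and T is fixed,
    and the sum runs over the S in U with singleton complement. *)
Lemma iter_Lj j t : iter j (Lj 1) t = qfact p j *: Lj j t.
Proof.
move: j t; apply: iter_qfact => [E G|j E G].
  by rewrite LjT big_fpowerset_card0 inversions0l scale1r v0 mulr1 fsetD0.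
pose f S T U := if (#|` S| == j) && (#|` T| == 1%N)
  then (c S (G `\` S) * c T U) *: tens (v E * v S * v T) (v U) else 0.
transitivity (\sum_(S <- fpowerset G) \sum_(T <- fpowerset (G `\` S))
    f S T (G `\` S `\` T)).
  rewrite LjT linear_sum big_mkcond; apply: eq_big_seq => S.
  rewrite fpowersetE => sSG; rewrite /f; case: eqP => _; last first.
    by rewrite big1.
  rewrite linearZ /= LjT scaler_sumr big_mkcond; apply: eq_bigr => T _.
  by case: ifP => // _; rewrite scalerA.
rewrite fpowerset_coassoc LjT scaler_sumr [RHS]big_mkcond.
apply: eq_big_seq => U; rewrite fpowersetE => sUG.
transitivity (\sum_(S <- fpowerset U | #|` U `\` S| == 1%N)
   if #|` U| == j.+1 then
     p ^+ inversions S (U `\` S) *: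
       (c U (G `\` U) *: tens (v E * v U) (v (G `\` U))) else 0).
  rewrite [RHS]big_mkcond; apply: eq_big_seq => S.
  rewrite fpowersetE => sSU; rewrite /f andbC; have [T1|//] := eqP => /=.
  have -> : (#|` S| == j) = (#|` U| == j.+1).
    by rewrite -(cardfsID S U) (fsetIidPr sSU) T1 addn1 eqSS.
  case: eqP => // _; rewrite -exprD inversions_coassoc // exprD.
  rewrite -(mulrA (v E)) v_setD // -scalerAr -!tenslE linearZ !scalerA.
  by rewrite -mulrA -exprMn mulrN1 opprK mulrC.
case: eqP => [<-|_]; last by rewrite big1.
by rewrite -scaler_suml sum_inversions_cardD1.
Qed.

(** The three results are bundled so that the abstract data are instantiated only once. *)
Lemma tauh_Lj_Rj :
  [/\ forall E G, tauh (w E G) =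
        \sum_(0 <= k < (minn #|` E| #|` G|).+1) gamma p k *:
          Lj (#|` G| - k) (Rj (#|` E| - k) (w E G)),
      forall j t, iter j (Lj 1) t = qfact p j *: Lj j t &
      forall j t, iter j (Rj 1) t = qfact p j *: Rj j t].
Proof.
split; [|exact: iter_Lj|exact: iter_Rj] => E G.
rewrite tauhE; apply: eq_bigr => k _; congr (_ *: _).
rewrite RjT linear_sum; apply: eq_bigr => S _.
by rewrite linearZ /= LjE.
Qed.

End BraidedExterior.

(** * Linear maps on free modules and their tensor products *)

Section FreeModule.
Variable F : fieldType.

HB.instance Definition _ (I J : choiceType) (x : {malg F[I]}) :=
  GRing.isLinear.Build F {malg F[J]} {malg F[(I * J)%type]} _ (tensor x)
    (tensorDZr x).

Lemma linear_lext (I J : choiceType) (W : lmodType F)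
    (f : {linear {malg F[I]} -> W}) (h : J -> {malg F[I]}) x :
  f (lext h x) = lext (fun j => f (h j)) x.
Proof. by rewrite linear_sum; apply: eq_bigr => j _; rewrite linearZ. Qed.

Lemma eq_lext (I : choiceType) (W : lmodType F) (h h' : I -> W) x :
  h =1 h' -> lext h x = lext h' x.
Proof. by move=> hh'; apply: eq_bigr => i _; rewrite hh'. Qed.

Lemma tensmU (I J I' J' : choiceType) (f : {malg F[I]} -> {malg F[I']})
    (g : {malg F[J]} -> {malg F[J']}) i j :
  (f \otm g) << (i, j) >> = f << i >> \ot g << j >>.
Proof. by rewrite /tensm lextU. Qed.

(** The map x |-> x (x) y, written as a [lext] so that it inherits a linear structure. *)
Definition tensorl (J : choiceType) (y : {malg F[J]}) (I : choiceType) :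
    {malg F[I]} -> {malg F[(I * J)%type]} :=
  lext (fun i => lext (fun j => << (i, j) >> : {malg F[(I * J)%type]}) y).
HB.instance Definition _ (J : choiceType) (y : {malg F[J]}) I :=
  GRing.Linear.on (@tensorl J y I).

Lemma midU (I : choiceType)
    (f : {malg F[(I * I)%type]} -> {malg F[(I * I)%type]}) (i j k l : I) :
  mid f << ((i, j), (k, l)) >> =
  lext (fun x => << ((i, x.1), (x.2, l)) >>) (f << (j, k) >>).
Proof.
rewrite /mid /= /assocr lextU /= tensmU /= /assocl lextU /= tensmU.
rewrite -!/assocr -!/assocl.
apply: (malg_linear_ext (f := @assocl F _ _ _ \o tensor << i >> \o
    @assocr F _ _ _ \o @tensorl I << l >> _)
  (g := lext (fun x => << ((i, x.1), (x.2, l)) >>))) => -[a b].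
by rewrite /= /tensorl /= !lextU /= /assocr lextU tensorU /assocl lextU.
Qed.

End FreeModule.

(** * The braiding of the exterior algebra *)

Section ExteriorBraiding.
Local Open Scope fset_scope.
Local Open Scope ring_scope.
Variables (F : fieldType) (d : Order.disp_t) (B : orderType d).
Local Notation La := (extalg F B).
Local Notation LaLa := (extsq F B).
Local Notation bas E := (<< E >> : extalg F B).
Implicit Types (e : B) (E S T U G H : {fset B}).

Lemma extmulE E G : bas E * bas G = extmulb F E G.
Proof. by rewrite -[LHS]/(extmul _ _) /extmul !lextU. Qed.

Definition lmul (x : La) : LaLa -> LaLa :=
  lext (fun k => (x * bas k.1) \ot bas k.2).
HB.instance Definition _ x := GRing.Linear.on (lmul x).

Definition rmul (y : La) : LaLa -> LaLa :=
  lext (fun k => bas k.1 \ot (bas k.2 * y)).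
HB.instance Definition _ y := GRing.Linear.on (rmul y).

Lemma nablaU E G : nabla << (E, G) >> = bas E * bas G.
Proof. exact: lextU. Qed.

Lemma nabla2U E G S T : (nabla \otm nabla) << ((E, G), (S, T)) >> =
  (bas E * bas G) \ot (bas S * bas T).
Proof.
exact: (etrans (tensmU _ _ _ _) (f_equal2 _ (nablaU E G) (nablaU S T))).
Qed.

(** Rewrites the outer composite in [opL] as a left multiplication; [rmulE] does the same for
    [opR]. *)
Lemma lmulE (x : La) t : (nabla \otm id) (assocl (x \ot t)) = lmul x t.
Proof.
apply: (malg_linear_ext (f := (nabla \otm id) \o assocl \o tensor x)
  (g := lmul x)) => -[S T].
transitivity ((x * bas S) \ot bas T); last exact/esym/lextU.
rewrite -(nablaE x (bas S)).
apply: (malg_linear_ext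
  (f := (nabla \otm id) \o assocl \o @tensorl F _ << (S, T) >> {fset B})
  (g := @tensorl F _ << T >> {fset B} \o nabla \o
    @tensorl F _ << S >> {fset B})) => E.
change ((nabla \otm id) (assocl (bas E \ot (<< (S, T) >> : LaLa))) =
  nabla (bas E \ot bas S) \ot bas T).
by rewrite !tensorU {1}/assocl lextU; exact: tensmU.
Qed.

Lemma rmulE (x : La) t : (id \otm nabla) (assocr (t \ot x)) = rmul x t.
Proof.
apply: (malg_linear_ext (f := (id \otm nabla) \o assocr \o @tensorl F _ x _)
  (g := rmul x)) => -[S T].
transitivity (bas S \ot (bas T * x)); last exact/esym/lextU.
rewrite -(nablaE (bas T) x).
apply: (malg_linear_ext
  (f := (id \otm nabla) \o assocr \o @tensor F _ {fset B} << (S, T) >>)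
  (g := @tensor F _ {fset B} << S >> \o nabla \o
    @tensor F _ {fset B} << T >>)) => E.
change ((id \otm nabla) (assocr ((<< (S, T) >> : LaLa) \ot bas E)) =
  bas S \ot nabla (bas T \ot bas E)).
by rewrite !tensorU {1}/assocr lextU; exact: tensmU.
Qed.

Lemma lmul_tensor (x y z : La) : lmul x (y \ot z) = (x * y) \ot z.
Proof.
have lE t : lmul x t = ((nabla \o tensor x) \otm idfun) t.
  apply: eq_lext => k.
  exact: (congr1 (fun u => u \ot bas k.2) (esym (nablaE x (bas k.1)))).
apply: etrans (lE _) _; apply: etrans (tensm_tensor _ _ _ _) _.
exact: (congr1 (fun u => u \ot z) (nablaE x y)).
Qed.

Lemma rmul_tensor (x y z : La) : rmul x (y \ot z) = y \ot (z * x).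
Proof.
have rE t : rmul x t = (idfun \otm (nabla \o @tensorl F _ x _)) t.
  apply: eq_lext => k.
  exact: (congr1 (tensor (bas k.1)) (esym (nablaE (bas k.2) x))).
apply: etrans (rE _) _; apply: etrans (tensm_tensor _ _ _ _) _.
exact: (congr1 (tensor y) (nablaE z x)).
Qed.

Lemma projU n E : proj n (bas E) = if #|` E| == n then bas E else 0.
Proof. by rewrite -(extbE F E) [in LHS]extbE; exact: lextU. Qed.

Variables (p : F) (tauh : {linear LaLa -> LaLa}).
Hypothesis tauhP : is_braiding p tauh.

Lemma tauh0l E : tauh << (fset0, E) >> = << (E, fset0) >>.
Proof. by have [_ h _ _] := tauhP; have := h (bas E); rewrite !tensorU. Qed.

Lemma tauh0r E : tauh << (E, fset0) >> = << (fset0, E) >>.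
Proof. by have [_ _ h _] := tauhP; have := h (bas E); rewrite !tensorU. Qed.

Lemma iota1U (b : B) : iota1 << b >> = bas [fset b].
Proof. exact: lextU. Qed.

Lemma iota1_tensor (a b : B) :
  (iota1 \otm iota1) << (a, b) >> = << ([fset a], [fset b]) >> :> LaLa.
Proof.
apply: etrans (tensmU _ _ _ _) _.
exact: etrans (f_equal2 _ (iota1U a) (iota1U b)) (tensorU _ _ _).
Qed.

Lemma tauh11 (a b : B) : tauh << ([fset a], [fset b]) >> =
  if a == b then - << ([fset a], [fset b]) >>
  else if (b < a)%O
  then - ((1 - p) *: << ([fset a], [fset b]) >>) - << ([fset b], [fset a]) >>
  else - (p *: << ([fset b], [fset a]) >>).
Proof.
have [h _ _ _] := tauhP.
apply: etrans (congr1 tauh (esym (iota1_tensor a b))) _.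
apply: etrans (h << (a, b) >>) _.
have -> : tau p << (a, b) >> = if a == b then - << (a, b) >>
  else if (b < a)%O then - ((1 - p) *: << (a, b) >>) - << (b, a) >>
  else - (p *: << (b, a) >>) by exact: lextU.
case: ifP => _; first by rewrite linearN /= iota1_tensor.
case: ifP => _; last by rewrite linearN linearZ /= iota1_tensor.
by rewrite linearB linearN linearZ /= !iota1_tensor.
Qed.

Lemma braidM E G H T : tauh ((bas E * bas G) \ot (bas H * bas T)) =
  (nabla \otm nabla)
    (mid tauh ((tauh \otm tauh) (mid tauh << ((E, G), (H, T)) >>))).
Proof.
have [_ _ _ /(_ << ((E, G), (H, T)) >>) h] := tauhP.
by rewrite -nabla2U; exact: h.
Qed.

(** The multiplicativity axiom at f_E (x) 1 (x) f_G (x) f_H. The unit makes the first middle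
    braiding and the second outer one flips, which leaves two genuine braidings. *)
Lemma hexagonr E G H : tauh (bas E \ot (bas G * bas H)) =
  lext (fun k => lmul (bas k.1) (tauh << (k.2, H) >>)) (tauh << (E, G) >>).
Proof.
have e1 : bas E * bas fset0 = bas E by exact: mulr1.
have h1 : mid tauh << ((E, fset0), (G, H)) >> = << ((E, G), (fset0, H)) >>.
  apply: etrans (midU _ _ _ _ _) _.
  exact: etrans (congr1 (lext _) (tauh0l G)) (lextU _ _).
have h2 : (tauh \otm tauh) << ((E, G), (fset0, H)) >> =
    tauh << (E, G) >> \ot << (H, fset0) >>.
  exact: etrans (tensmU _ _ _ _) (congr1 (tensor _) (tauh0l H)).
transitivity ((nabla \otm nabla)
  (mid tauh (tauh << (E, G) >> \ot << (H, fset0) >>))).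
  have := etrans (braidM E fset0 G H) (congr1 (fun t => (nabla \otm nabla)
    (mid tauh t)) (etrans (congr1 (tauh \otm tauh) h1) h2)).
  exact: etrans (congr1 (fun x => tauh (tensor x (bas G * bas H))) (esym e1)).
apply: (malg_linear_ext (f := (nabla \otm nabla) \o mid tauh \o
    @tensorl F _ << (H, fset0) >> _)
  (g := lext (fun k => lmul (bas k.1) (tauh << (k.2, H) >>)))) => -[S T].
change ((nabla \otm nabla) (mid tauh (<< (S, T) >> \ot << (H, fset0) >>)) =
  lext (fun k => lmul (bas k.1) (tauh << (k.2, H) >>)) << (S, T) >>).
rewrite tensorU lextU midU linear_lext; apply: eq_lext => k.
apply: etrans (nabla2U _ _ _ _) _.
exact: (congr1 (fun y => (bas S * bas k.1) \ot y) (mulr1 (bas k.2))).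
Qed.

(** The multiplicativity axiom at f_E (x) f_G (x) 1 (x) f_H. *)
Lemma hexagonl E G H : tauh ((bas E * bas G) \ot bas H) =
  lext (fun k => rmul (bas k.2) (tauh << (E, k.1) >>)) (tauh << (G, H) >>).
Proof.
have e1 : bas fset0 * bas H = bas H by exact: mul1r.
have h1 : mid tauh << ((E, G), (fset0, H)) >> = << ((E, fset0), (G, H)) >>.
  apply: etrans (midU _ _ _ _ _) _.
  exact: etrans (congr1 (lext _) (tauh0r G)) (lextU _ _).
have h2 : (tauh \otm tauh) << ((E, fset0), (G, H)) >> =
    << (fset0, E) >> \ot tauh << (G, H) >>.
  exact: etrans (tensmU _ _ _ _)
    (congr1 (fun t => tensor t (tauh << (G, H) >>)) (tauh0r E)).
transitivity ((nabla \otm nabla)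
  (mid tauh (<< (fset0, E) >> \ot tauh << (G, H) >>))).
  have := etrans (braidM E G fset0 H) (congr1 (fun t => (nabla \otm nabla)
    (mid tauh t)) (etrans (congr1 (tauh \otm tauh) h1) h2)).
  exact: etrans (congr1 (fun x => tauh (tensor (bas E * bas G) x)) (esym e1)).
apply: (malg_linear_ext (f := (nabla \otm nabla) \o mid tauh \o
    tensor << (fset0, E) >>)
  (g := lext (fun k => rmul (bas k.2) (tauh << (E, k.1) >>)))) => -[S T].
change ((nabla \otm nabla) (mid tauh (<< (fset0, E) >> \ot << (S, T) >>)) =
  lext (fun k => rmul (bas k.2) (tauh << (E, k.1) >>)) << (S, T) >>).
rewrite tensorU lextU midU linear_lext; apply: eq_lext => k.
apply: etrans (nabla2U _ _ _ _) _.
exact: (congr1 (fun y => y \ot (bas k.2 * bas T)) (mul1r (bas k.1))).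
Qed.

(** * The coproduct of the exterior algebra *)

Variable Delta : {linear La -> LaLa}.
Hypothesis DeltaP : is_coproduct tauh Delta.

(** Reduction to basis tensors in three stages: [key2] for the output of the braiding, [key1] for
    Delta f_T, and finally Delta f_S. *)
Lemma DeltaM S T : Delta (bas S * bas T) =
  lext (fun k => lmul (bas k.1)
    (lext (fun l => rmul (bas l.2) (tauh << (k.2, l.1) >>)) (Delta (bas T))))
    (Delta (bas S)).
Proof.
have [_ _ /(_ << (S, T) >>) h] := DeltaP.
apply: etrans (congr1 Delta (esym (nablaU S T))) _; apply: etrans h _.
transitivity ((nabla \otm nabla) (mid tauh (Delta (bas S) \ot Delta (bas T)))).
  exact: (congr1 (fun t => (nabla \otm nabla) (mid tauh t)) (tensmU _ _ _ _)).
have key2 S1 T2 t : (nabla \otm nabla)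
    (lext (fun k => << ((S1, k.1), (k.2, T2)) >>) t) =
    lmul (bas S1) (rmul (bas T2) t).
  apply: (malg_linear_ext (f := (nabla \otm nabla) \o
      lext (fun k => << ((S1, k.1), (k.2, T2)) >>))
    (g := lmul (bas S1) \o rmul (bas T2))) => -[U1 U2].
  apply: etrans (congr1 (nabla \otm nabla) (lextU _ _)) _.
  apply: etrans (nabla2U _ _ _ _) _.
  apply: etrans _ (congr1 (lmul (bas S1)) (esym (lextU _ _))).
  exact: esym (lmul_tensor _ _ _).
have key1 S1 S2 u : (nabla \otm nabla) (mid tauh (<< (S1, S2) >> \ot u)) =
    lmul (bas S1) (lext (fun l => rmul (bas l.2) (tauh << (S2, l.1) >>)) u).
  apply: (malg_linear_ext (f := (nabla \otm nabla) \o mid tauh \o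
      tensor << (S1, S2) >>)
    (g := lmul (bas S1) \o
      lext (fun l => rmul (bas l.2) (tauh << (S2, l.1) >>)))) => -[T1 T2].
  apply: etrans _ (congr1 (lmul (bas S1)) (esym (lextU _ _))).
  apply: etrans _ (key2 S1 T2 (tauh << (S2, T1) >>)).
  apply: (congr1 (nabla \otm nabla)); apply: etrans _ (midU _ _ _ _ _).
  exact: (congr1 (mid tauh) (tensorU _ _ _)).
apply: (malg_linear_ext (f := (nabla \otm nabla) \o mid tauh \o
    @tensorl F _ (Delta (bas T)) _)
  (g := lext (fun k => lmul (bas k.1) (lext
    (fun l => rmul (bas l.2) (tauh << (k.2, l.1) >>)) (Delta (bas T)))))).
move=> -[S1 S2].
apply: etrans (key1 S1 S2 (Delta (bas T))) _; apply: esym.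
exact: lextU.
Qed.

(** * Instances of the abstract data, bundled as linear maps *)

Definition tensor_lin (x : La) : {linear La -> LaLa} := tensor x.
Definition tensorl_lin (y : La) : {linear La -> LaLa} := @tensorl F _ y _.
Definition lmul_lin (x : La) : {linear LaLa -> LaLa} := lmul x.
Definition rmul_lin (x : La) : {linear LaLa -> LaLa} := rmul x.
Definition ext_lin (h : {fset B} -> {fset B} -> LaLa) : {linear LaLa -> LaLa} :=
  lext (fun k => h k.1 k.2).
Definition proj_l n : {linear LaLa -> LaLa} := proj n \otm id.
Definition proj_r n : {linear LaLa -> LaLa} := id \otm proj n.

Lemma tensor_lin_ind (P : LaLa -> Prop) : P 0 ->
  (forall a s t, P s -> P t -> P (a *: s + t)) ->
  (forall S T, P (tensor_lin (bas S) (bas T))) -> forall t, P t.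
Proof.
move=> P0 PD Pw t; rewrite (malg_expand t).
elim: (enum_fset _) => [|k r IHr]; first by rewrite big_nil.
rewrite big_cons; apply: (PD) => //; case: k => S T.
by rewrite -[<< _ >>](tensorU F S T); exact: Pw.
Qed.

Lemma ext_lin_tensor h S T : ext_lin h (tensor_lin (bas S) (bas T)) = h S T.
Proof. exact: etrans (congr1 (ext_lin h) (tensorU _ _ _)) (lextU _ _). Qed.

Lemma proj_l_tensor n S T : proj_l n (tensor_lin (bas S) (bas T)) =
  if #|` S| == n then tensor_lin (bas S) (bas T) else 0.
Proof.
apply: etrans (congr1 (proj_l n) (tensorU _ _ _)) _.
apply: etrans (tensmU _ _ _ _) _.
apply: etrans (congr1 (fun u => u \ot bas T) (projU n S)) _.
by case: ifP => // _; exact: (linear0 (tensorl_lin (bas T))).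
Qed.

Lemma proj_r_tensor n S T : proj_r n (tensor_lin (bas S) (bas T)) =
  if #|` T| == n then tensor_lin (bas S) (bas T) else 0.
Proof.
apply: etrans (congr1 (proj_r n) (tensorU _ _ _)) _.
apply: etrans (tensmU _ _ _ _) _.
apply: etrans (congr1 (tensor_lin (bas S)) (projU n T)) _.
by case: ifP => // _; exact: (linear0 (tensor_lin (bas S))).
Qed.

Lemma tauh_1tensor E :
  tauh (tensor_lin (bas fset0) (bas E)) = tensor_lin (bas E) (bas fset0).
Proof. by have [_ h _ _] := tauhP; exact: h. Qed.

Lemma tauh_tensor1 E :
  tauh (tensor_lin (bas E) (bas fset0)) = tensor_lin (bas fset0) (bas E).
Proof. by have [_ _ h _] := tauhP; exact: h. Qed.

Lemma tauh_tensor11 (a b : B) :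
  tauh (tensor_lin (bas [fset a]) (bas [fset b])) =
  if a == b then - tensor_lin (bas [fset a]) (bas [fset b])
  else if (b < a)%O
  then - ((1 - p) *: tensor_lin (bas [fset a]) (bas [fset b]))
    - tensor_lin (bas [fset b]) (bas [fset a])
  else - (p *: tensor_lin (bas [fset b]) (bas [fset a])).
Proof.
have tE x y : tensor_lin (bas [fset x]) (bas [fset y]) =
  << ([fset x], [fset y]) >> by exact: tensorU.
by rewrite !tE; exact: tauh11.
Qed.

Lemma hexagonr_tensor E G H : tauh (tensor_lin (bas E) (bas G * bas H)) =
  ext_lin (fun S T => lmul_lin (bas S) (tauh (tensor_lin (bas T) (bas H))))
    (tauh (tensor_lin (bas E) (bas G))).
Proof.
apply: etrans (hexagonr E G H) _.
apply: etrans (congr1 (lext _) (congr1 tauh (esym (tensorU _ _ _)))) _.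
apply: eq_lext => k.
exact: (congr1 (fun t => lmul (bas k.1) (tauh t)) (esym (tensorU _ _ _))).
Qed.

Lemma hexagonl_tensor E G H : tauh (tensor_lin (bas E * bas G) (bas H)) =
  ext_lin (fun S T => rmul_lin (bas T) (tauh (tensor_lin (bas E) (bas S))))
    (tauh (tensor_lin (bas G) (bas H))).
Proof.
apply: etrans (hexagonl E G H) _.
apply: etrans (congr1 (lext _) (congr1 tauh (esym (tensorU _ _ _)))) _.
apply: eq_lext => k.
exact: (congr1 (fun t => rmul (bas k.2) (tauh t)) (esym (tensorU _ _ _))).
Qed.

Lemma DeltaM_tensor S T : Delta (bas S * bas T) =
  ext_lin (fun S1 S2 => lmul_lin (bas S1)
    (ext_lin (fun T1 T2 =>
        rmul_lin (bas T2) (tauh (tensor_lin (bas S2) (bas T1))))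
      (Delta (bas T))))
    (Delta (bas S)).
Proof.
apply: etrans (DeltaM S T) _; apply: eq_lext => k.
apply: (congr1 (lmul (bas k.1))); apply: eq_lext => l.
exact: (congr1 (fun t => rmul (bas l.2) (tauh t)) (esym (tensorU _ _ _))).
Qed.

Lemma Delta_prim_tensor e : Delta (bas [fset e]) =
  tensor_lin (bas [fset e]) (bas fset0) + tensor_lin (bas fset0) (bas [fset e]).
Proof. by have [_ h _] := DeltaP; have := h << e >>; rewrite iota1U. Qed.

(** At j = 1 this is [opR Delta] by conversion, and [Lpow 1] is likewise [opL Delta]. *)
Definition Rpow j : {linear LaLa -> LaLa} :=
  (id \otm nabla) \o assocr \o (Delta_r Delta j \otm id).
Definition Lpow j : {linear LaLa -> LaLa} :=
  (nabla \otm id) \o assocl \o (id \otm Delta_l Delta j).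

Lemma Rpow_tensor j x y :
  Rpow j (tensor_lin x y) = rmul_lin y (proj_r j (Delta x)).
Proof.
apply: etrans (rmulE _ _); apply: (congr1 ((id \otm nabla) \o assocr)).
exact: (tensm_tensor ((id \otm proj j) \o Delta) idfun).
Qed.

Lemma Lpow_tensor j x y :
  Lpow j (tensor_lin x y) = lmul_lin x (proj_l j (Delta y)).
Proof.
apply: etrans (lmulE _ _); apply: (congr1 ((nabla \otm id) \o assocl)).
exact: (tensm_tensor idfun ((proj j \otm id) \o Delta)).
Qed.

Lemma tauh_Lpow_Rpow :
  [/\ forall E G, tauh (tensor_lin (bas E) (bas G)) =
        \sum_(0 <= k < (minn #|` E| #|` G|).+1) gamma p k *:
          Lpow (#|` G| - k) (Rpow (#|` E| - k) (tensor_lin (bas E) (bas G))),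
      forall j t, iter j (opL Delta) t = qfact p j *: Lpow j t &
      forall j t, iter j (opR Delta) t = qfact p j *: Rpow j t].
Proof.
have [D1 _ _] := DeltaP.
exact: (tauh_Lj_Rj (fun x y => erefl : tensorl_lin y x = tensor_lin x y)
  tensor_lin_ind (erefl _) extmulE
  (lmul_tensor : forall x y z, lmul_lin x (tensor_lin y z) = _)
  (rmul_tensor : forall x y z, rmul_lin x (tensor_lin y z) = _)
  ext_lin_tensor proj_l_tensor tauh_1tensor tauh_tensor1 tauh_tensor11
  hexagonr_tensor hexagonl_tensor
  D1 Delta_prim_tensor DeltaM_tensor proj_r_tensor Lpow_tensor Rpow_tensor).
Qed.

End ExteriorBraiding.

(** * The two forms of the braiding formula *)

Theorem proposition3 (F : fieldType) (d : Order.disp_t) (B : orderType d)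
  (p : F) (p_neq0 : p != 0)
  (qnum_neq0 : forall n : nat, (1 <= n)%N -> qnum p n != 0)
  (tauh : {linear extsq F B -> extsq F B}) (tauhP : is_braiding p tauh)
  (Delta : {linear extalg F B -> extsq F B})
  (DeltaP : is_coproduct tauh Delta) :
  (forall E G : {fset B},
     tauh (extb F E \ot extb F G) =
     \sum_(0 <= k < (minn #|` E| #|` G|).+1)
       gamma p k *:
         (qdivpow p (#|` G| - k) (opL Delta) \o
          qdivpow p (#|` E| - k) (opR Delta)) (extb F E \ot extb F G))
  /\
  (forall (m n : nat) (t : extsq F B),
     tauh ((proj m \otm proj n) t) =
     \sum_(0 <= k < (minn m n).+1)
       gamma p k *:
         ((nabla \otm id) \o assocl \o (id \otm Delta_l Delta (n - k)) \o
          (id \otm nabla) \o assocr \o (Delta_r Delta (m - k) \otm id) \o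
          (proj m \otm proj n)) t).
Proof.
have qfact_neq0 n : qfact p n != 0.
  by rewrite /qfact big_nat; elim/big_rec: _ => [|i x /andP[i1 _] x0];
    rewrite ?oner_neq0 // mulf_neq0 // qnum_neq0.
have [tauhE iterL iterR] := tauh_Lpow_Rpow tauhP DeltaP.
split=> [E G|m n t].
  rewrite !extbE; apply: etrans (tauhE E G) _.
  apply: eq_bigr => k _; congr (_ *: _); apply: esym.
  (* The factorials produced by the iterates cancel the denominators of the divided powers. *)
  rewrite -[LHS]/(qdivpow p _ _ (qdivpow p _ _ _)) /qdivpow iterL iterR.
  by rewrite !scalerA !mulVf // !scale1r.
pose pp : {linear extsq F B -> extsq F B} := proj m \otm proj n.
have ppT S T : pp (tensor_lin << S >> << T >>) =
    if (#|` S| == m) && (#|` T| == n) then tensor_lin << S >> << T >> else 0.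
  apply: etrans (tensm_tensor _ _ _ _) _.
  apply: etrans (f_equal2 _ (projU F m S) (projU F n T)) _.
  case: eqP => _ /=; last exact: (linear0 (tensorl_lin _)).
  by case: eqP => // _; exact: (linear0 (tensor_lin _)).
(* The composite in the statement is convertible to [Lpow] after [Rpow]. On a basis tensor [pp] is
   either the identity, where the first form applies with m = |S| and n = |T|, or zero. *)
suff: tauh (pp t) = \sum_(0 <= k < (minn m n).+1)
    gamma p k *: Lpow Delta (n - k) (Rpow Delta (m - k) (pp t)) by [].
apply: (tens_eq_sum (tens := @tensor_lin F d B) (@tensor_lin_ind F d B)
  (f := tauh) (g := fun k => Lpow Delta (n - k))
  (h := fun k => Rpow Delta (m - k))) => S T.
rewrite ppT; have [|_] := boolP (_ && _).
  by case/andP=> /eqP <- /eqP <-; exact: tauhE.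
rewrite (linear0 tauh) big1 // => k _.
by rewrite (linear0 (Rpow _ _)) (linear0 (Lpow _ _)) scaler0.
Qed.
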